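(* Let $G$ be a connected, simply connected complex simple Lie group of rank $r$ with Cartan matrix $(a_{ij})$, let $w=s_{i_1}\cdots s_{i_r}$ be a reduced decomposition of a Coxeter element of its Weyl group, and let $\alpha$ be the map given on coordinates $(\chi^+_i,\chi^-_i)_{i=1}^r$ of $(\mathbb C^\times)^{2r}$, outside the hypersurfaces $\chi^-_j=1$, by $$\alpha(\chi^+_i)=\chi^-_i,\qquad \alpha(\chi^-_i)=\frac{(\chi^-_i)^2}{\chi^+_i}\prod_{j=1}^r(1-\chi^-_j)^{-a_{ji}} .$$ Then for every finite-dimensional representation $V$ of $G$, $$\mathrm{Ch}_V(\alpha(\chi^+),\alpha(\chi^-))=\mathrm{Ch}_V(\chi^+,\chi^-),$$ where $$\mathrm{Ch}_V(\chi^+,\chi^-)=\mathrm{Tr}_V\Big(\prod_{j=1}^r\Big(\frac{\chi^+_j}{\chi^-_j}\Big)^{h^j}\phi_{i_1}(g_{i_1})\cdots\phi_{i_r}(g_{i_r})\Big),\qquad g_i=\begin{pmatrix}1-\chi^-_i&\chi^-_i\\-1&1\end{pmatrix}.$$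
   Context: $x_i^\pm,h_i$ ($1\le i\le r$) are Chevalley generators of $\mathfrak g=\mathrm{Lie}(G)$: $[h_i,x_j^\pm]=\pm a_{ij}x_j^\pm$, $[x_i^+,x_j^-]=\delta_{ij}h_i$. $\phi_i:SL_2\to G$ is the homomorphism whose differential sends the standard basis $E,H,F$ of $\mathfrak{sl}_2$ to $x_i^+,h_i,x_i^-$. The elements $h^j$ of the Cartan subalgebra are defined by $h_j=\sum_i a_{ji}h^i$, so $[h^j,x_i^\pm]=\pm\delta_{ij}x_i^\pm$. A Coxeter element is a product of all simple reflections, each appearing exactly once. For $z\in\mathbb C^\times$, $z^{h_j}=\phi_j(\mathrm{diag}(z,z^{-1}))$ is single valued. The operator $z^{h^j}=\exp((\log z)h^j)$ on $V$ depends on a choice of $\log z$; changing the choice multiplies it by the action of a central element of $G$. In the asserted equality the choices are made compatibly: $\prod_j\big(\alpha(\chi^+_j)/\alpha(\chi^-_j)\big)^{h^j}=\prod_j(\chi^+_j/\chi^-_j)^{h^j}\prod_j(1-\chi^-_j)^{h_j}$. *)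

(* Defs.v *)
From HB Require Import structures.
From mathcomp Require Import all_boot all_order all_algebra.
From mathcomp Require Import all_classical all_reals all_analysis.
From mathcomp Require Import complex.

Set Implicit Arguments.
Unset Strict Implicit.
Unset Printing Implicit Defensive.

Import Order.TTheory GRing.Theory Num.Theory numFieldNormedType.Exports.

Local Open Scope classical_set_scope.
Local Open Scope ring_scope.
Local Open Scope complex_scope.

(* The field of complex numbers is R[i] with R : realType.  Differentiability
   (and 'd) is taken over the numFieldType R[i], so it is complex
   differentiability; holomorphic means complex differentiable at every point
   of an open set. *)

(* The library puts the norm topology on variables K : numFieldType only, not
   on the concrete type R[i]. *)
#[non_forgetful_inheritance]
HB.instance Definition _ (R : realType) := NormedModule.copy R[i] R[i]^o.

(* No compatibility between group law and topology is required here; it is an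
   axiom of complexLieGroup. *)
#[short(type="preTopologicalGroupType")]
HB.structure Definition PreTopologicalGroup :=
  {G of Topological G & monoid.Group G}.

(* [chart_inv] is relevant only on the image of [chart_dom]. *)
Record chart (R : realType) (d : nat) (M : topologicalType) := Chart {
  chart_dom : set M;
  chart_map : M -> 'rV[R[i]]_d;
  chart_inv : 'rV[R[i]]_d -> M }.

Record is_chart (R : realType) (d : nat) (M : topologicalType)
    (c : chart R d M) : Prop := IsChart {
  chart_open_dom : open (chart_dom c);
  chart_open_img : open (chart_map c @` chart_dom c);
  chart_mapK : forall x, chart_dom c x -> chart_inv c (chart_map c x) = x;
  chart_map_cont : forall x, chart_dom c x -> {for x, continuous (chart_map c)};
  chart_inv_cont : forall x, chart_dom c x ->
    {for chart_map c x, continuous (chart_inv c)} }.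

Record is_atlas (R : realType) (d : nat) (M : topologicalType)
    (A : set (chart R d M)) : Prop := IsAtlas {
  atlas_chart : forall c, A c -> is_chart c;
  atlas_cover : forall x, exists2 c, A c & chart_dom c x;
  atlas_compat : forall c c', A c -> A c' ->
    forall x, chart_dom c x -> chart_dom c' x ->
    differentiable (chart_map c' \o chart_inv c) (chart_map c x) }.

Record complexLieGroup (R : realType) (d : nat) := ComplexLieGroup {
  lg_sort :> preTopologicalGroupType;
  lg_atlas : set (chart R d lg_sort);
  lg_hausdorff : hausdorff_space lg_sort;
  lg_second_countable : @second_countable lg_sort;
  lg_atlasP : is_atlas lg_atlas;
  lg_mul_continuous : continuous (fun p : lg_sort * lg_sort => (p.1 * p.2)%g);
  lg_inv_continuous : continuous (fun x : lg_sort => (x^-1)%g);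
  lg_mul_holomorphic : forall c1 c2 c3,
    lg_atlas c1 -> lg_atlas c2 -> lg_atlas c3 ->
    forall x y, chart_dom c1 x -> chart_dom c2 y -> chart_dom c3 (x * y)%g ->
    differentiable
      (fun p : 'rV[R[i]]_d * 'rV[R[i]]_d =>
         chart_map c3 (chart_inv c1 p.1 * chart_inv c2 p.2)%g)
      (chart_map c1 x, chart_map c2 y);
  lg_inv_holomorphic : forall c1 c2, lg_atlas c1 -> lg_atlas c2 ->
    forall x, chart_dom c1 x -> chart_dom c2 (x^-1)%g ->
    differentiable (fun u => chart_map c2 (chart_inv c1 u)^-1%g)
      (chart_map c1 x) }.

Definition path_connected (R : realType) (T : topologicalType) : Prop :=
  forall x y : T, exists p : R -> T,
    [/\ {within `[0, 1], continuous p}, p 0 = x & p 1 = y].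

Definition simply_connected (R : realType) (T : topologicalType) : Prop :=
  path_connected R T /\
  forall p : R -> T, {within `[0, 1], continuous p} -> p 0 = p 1 ->
    exists H : R * R -> T,
      {within `[0, 1] `*` `[0, 1], continuous H} /\
      forall t : R, 0 <= t <= 1 ->
        [/\ H (0, t) = p t, H (1, t) = p 0, H (t, 0) = p 0 & H (t, 1) = p 0].

(* In all that follows, [e] is a chart at the unit of G; it identifies the
   tangent space Lie(G) = T_1 G with 'rV[R[i]]_d. *)
Definition chart_at1 (R : realType) (d : nat) (G : complexLieGroup R d)
    (e : chart R d G) : Prop :=
  lg_atlas e /\ chart_dom e 1%g.

Definition Ad (R : realType) (d : nat) (G : complexLieGroup R d)
    (e : chart R d G) (g : G) : 'rV[R[i]]_d -> 'rV[R[i]]_d :=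
  'd (fun u : 'rV[R[i]]_d => chart_map e (g * chart_inv e u * g^-1)%g)
     (chart_map e 1%g).

(* [X, Y] = ad X Y, where ad is the differential of Ad at 1; the sign is the
   one for which [X, Y] = X Y - Y X in GL_n. *)
Definition is_lie_bracket (R : realType) (d : nat) (G : complexLieGroup R d)
    (e : chart R d G)
    (br : 'rV[R[i]]_d -> 'rV[R[i]]_d -> 'rV[R[i]]_d) : Prop :=
  forall X Y : 'rV[R[i]]_d,
    is_derive (chart_map e 1%g) X
      (fun u : 'rV[R[i]]_d => Ad e (chart_inv e u) Y) (br X Y).

Definition simple_lie_algebra (R : realType) (d : nat)
    (br : 'rV[R[i]]_d -> 'rV[R[i]]_d -> 'rV[R[i]]_d) : Prop :=
  (exists X Y, br X Y != 0) /\
  forall I : {vspace 'rV[R[i]]_d},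
    (forall X Y, Y \in I -> br X Y \in I) -> I = 0%VS \/ I = fullv.

(* Cartan matrices of finite type; indecomposability is not part of it. *)
Definition cartan_matrix (r : nat) (a : 'M[int]_r) : Prop :=
  [/\ forall i, a i i = 2,
      forall i j, i != j -> a i j <= 0,
      forall i j, a i j = 0 -> a j i = 0
    & exists2 D : 'I_r -> int,
        forall i, 0 < D i
      & (forall i j, D i * a i j = D j * a j i) /\
        (forall v : 'I_r -> int, (exists i, v i != 0) ->
           0 < \sum_i \sum_j v i * (D i * a i j) * v j)].

Definition cartan_span (R : realType) (d r : nat) (h : 'I_r -> 'rV[R[i]]_d) :
    {vspace 'rV[R[i]]_d} :=
  <<codom h>>%VS.

(* [chev_free] and [chev_cartan] say that the h_i form a basis of a Cartan
   subalgebra (it acts diagonalisably because of the other relations); in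
   particular r is the rank. *)
Record chevalley_generators (R : realType) (d r : nat)
    (br : 'rV[R[i]]_d -> 'rV[R[i]]_d -> 'rV[R[i]]_d) (a : 'M[int]_r)
    (xp xm h : 'I_r -> 'rV[R[i]]_d) : Prop := ChevalleyGenerators {
  chev_free : free (codom h);
  chev_cartan : forall X,
    X \in cartan_span h <-> (forall i, br (h i) X = 0);
  chev_hxp : forall i j, br (h i) (xp j) = (a i j)%:~R *: xp j;
  chev_hxm : forall i j, br (h i) (xm j) = - ((a i j)%:~R *: xm j);
  chev_xpxm : forall i j, br (xp i) (xm j) = if i == j then h i else 0;
  chev_gen : forall W : {vspace 'rV[R[i]]_d},
    (forall i, [/\ xp i \in W, xm i \in W & h i \in W]) ->
    (forall X Y, X \in W -> Y \in W -> br X Y \in W) -> W = fullv }.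

Definition is_hdual (R : realType) (d r : nat) (a : 'M[int]_r)
    (h hd : 'I_r -> 'rV[R[i]]_d) : Prop :=
  (forall j, hd j \in cartan_span h) /\
  (forall j, h j = \sum_i (a j i)%:~R *: hd i).

Definition mx2 (R : realType) (p q s t : R[i]) : 'M[R[i]]_2 :=
  \matrix_(i, j) nth 0 (nth [::] [:: [:: p; q]; [:: s; t]] i) j.

(* SL_2 is a closed submanifold of 'M_2.  Maps from SL_2 are represented by
   functions on 'M_2 whose values at matrices of determinant <> 1 are
   irrelevant, and holomorphy on SL_2 is the local existence of a holomorphic
   extension to 'M_2: [F] extends [chart_map c \o phi] near [A]. *)
Definition sl2_extension (R : realType) (d : nat) (G : complexLieGroup R d)
    (c : chart R d G) (phi : 'M[R[i]]_2 -> G) (A : 'M[R[i]]_2)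
    (F : 'M[R[i]]_2 -> 'rV[R[i]]_d) : Prop :=
  \forall B \near A, differentiable F B /\
    (\det B = 1 -> chart_dom c (phi B) /\ F B = chart_map c (phi B)).

Record sl2_morphism (R : realType) (d : nat) (G : complexLieGroup R d)
    (phi : 'M[R[i]]_2 -> G) : Prop := SL2Morphism {
  sl2_morphM : forall A B, \det A = 1 -> \det B = 1 ->
    phi (A *m B) = (phi A * phi B)%g;
  sl2_morph_holomorphic : forall A c, \det A = 1 -> lg_atlas c ->
    chart_dom c (phi A) -> exists F, sl2_extension c phi A F }.

(* The differential of phi at 1 sends X to x.  This does not depend on the
   extension for X tangent to SL_2, that is, for \tr X = 0. *)
Definition sl2_differential (R : realType) (d : nat) (G : complexLieGroup R d)
    (e : chart R d G) (phi : 'M[R[i]]_2 -> G) (X : 'M[R[i]]_2)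
    (x : 'rV[R[i]]_d) : Prop :=
  exists2 F, sl2_extension e phi 1%:M F & 'd F (1%:M : 'M[R[i]]_2) X = x.

Definition sl2_triple_morphism (R : realType) (d : nat)
    (G : complexLieGroup R d) (e : chart R d G) (phi : 'M[R[i]]_2 -> G)
    (xp h xm : 'rV[R[i]]_d) : Prop :=
  [/\ sl2_morphism phi,
      sl2_differential e phi (mx2 0 1 0 0) xp,
      sl2_differential e phi (mx2 1 0 0 (-1)) h
    & sl2_differential e phi (mx2 0 0 1 0) xm].

Record representation (R : realType) (d n : nat) (G : complexLieGroup R d)
    (rho : G -> 'M[R[i]]_n) : Prop := Representation {
  repr1 : rho 1%g = 1%:M;
  reprM : forall x y, rho (x * y)%g = rho x *m rho y;
  repr_holomorphic : forall c, lg_atlas c -> forall x, chart_dom c x ->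
    differentiable (rho \o chart_inv c) (chart_map c x) }.

Definition drepr (R : realType) (d n : nat) (G : complexLieGroup R d)
    (e : chart R d G) (rho : G -> 'M[R[i]]_n) : 'rV[R[i]]_d -> 'M[R[i]]_n :=
  'd (rho \o chart_inv e) (chart_map e 1%g).

Definition expC (R : realType) (z : R[i]) : R[i] :=
  limn (series (fun k => z ^+ k / k`!%:R)).

Definition expm (R : realType) (n : nat) (A : 'M[R[i]]_n) : 'M[R[i]]_n :=
  limn (series (fun k => k`!%:R^-1 *: A ^+ k)).

(* Matrix of s_i in the basis of simple roots:
   s_i (alpha_j) = alpha_j - a_ij alpha_i is the j-th column. *)
Definition simple_reflection (r : nat) (a : 'M[int]_r) (i : 'I_r) : 'M[int]_r :=
  \matrix_(k, j) ((k == j)%:R - (k == i)%:R * a i j).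

Definition weyl_word (r : nat) (a : 'M[int]_r) (s : seq 'I_r) : 'M[int]_r :=
  \prod_(i <- s) simple_reflection a i.

Definition reduced_word (r : nat) (a : 'M[int]_r) (s : seq 'I_r) : Prop :=
  forall t, weyl_word a t = weyl_word a s -> (size s <= size t)%N.

Definition coxeter_element (r : nat) (a : 'M[int]_r) (w : 'M[int]_r) : Prop :=
  exists2 s, perm_eq s (enum 'I_r) & w = weyl_word a s.

Definition alpha_p (R : realType) (r : nat) (chip chim : 'I_r -> R[i])
    (i : 'I_r) : R[i] :=
  chim i.

Definition alpha_m (R : realType) (r : nat) (a : 'M[int]_r)
    (chip chim : 'I_r -> R[i]) (i : 'I_r) : R[i] :=
  chim i ^+ 2 / chip i * \prod_j (1 - chim j) ^ (- a j i).

Definition log_choice (R : realType) (r : nat) (chip chim : 'I_r -> R[i])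
    (lam : 'I_r -> R[i]) : Prop :=
  forall j, expC (lam j) = chip j / chim j.

(* The operator \prod_j z_j ^ (h^j) on V, where z_j ^ (h^j) is
   exp ((log z_j) h^j) and lam j stands for log z_j. *)
Definition torus_op (R : realType) (d r n : nat) (G : complexLieGroup R d)
    (e : chart R d G) (hd : 'I_r -> 'rV[R[i]]_d) (rho : G -> 'M[R[i]]_n)
    (lam : 'I_r -> R[i]) : 'M[R[i]]_n :=
  \prod_j expm (lam j *: drepr e rho (hd j)).

Definition gmx (R : realType) (z : R[i]) : 'M[R[i]]_2 := mx2 (1 - z) z (-1) 1.

(* Ch_V (chi^+, chi^-); it depends on chi^+ only through the chosen logarithms
   lam j of chi^+_j / chi^-_j. *)
Definition Ch (R : realType) (d r n : nat) (G : complexLieGroup R d)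
    (e : chart R d G) (hd : 'I_r -> 'rV[R[i]]_d)
    (phi : 'I_r -> 'M[R[i]]_2 -> G) (word : seq 'I_r)
    (rho : G -> 'M[R[i]]_n) (lam chim : 'I_r -> R[i]) : R[i] :=
  \tr (torus_op e hd rho lam *m
       rho (\prod_(i <- word) phi i (gmx (chim i)))%g).

(* Main.v *)
(* With [E i x = exp (x X_i)] and [F i x = exp (x Y_i)] the images of the root
   subgroups, [g_i = E i (m_i) F i (-1) = F i (-1/t_i) t_i^{h_i} E i (m_i/t_i)]
   where [m_i = chi^-_i] and [t_i = 1 - m_i]. As [E i] and [F j] commute for
   [i != j] and each index occurs once in a Coxeter word, the first form gives
   [prod g_i = (prod E i (m_i)) (prod F i (-1))]. Conjugation by the transformed
   torus element [T'] sends [E i (alpha m_i)] to [E i (m_i)], so the transformed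
   trace is [tr (T' (prod F i (-1)) (prod E i (m_i)))]. Collecting the torus
   factors in the second form of [g_i] turns the original trace into
   [tr (T' (prod F i (c_i)) (prod E i (d_i)))] with [c_i d_i = - m_i]; the two
   traces agree because conjugation by the torus can rescale [(c_i, d_i)] to
   [(-1, m_i)].
   The relations between exponentials are obtained from the differential
   of the representation: it is a Lie algebra morphism, and a one-parameter
   group of matrices is the exponential of its derivative. *)

Require Import Defs.
From mathcomp Require Import all_boot all_order all_algebra.
From mathcomp Require Import all_classical all_reals all_analysis.
From mathcomp Require Import complex ring lra.

Set Implicit Arguments.
Unset Strict Implicit.
Unset Printing Implicit Defensive.

Import Order.TTheory GRing.Theory Num.Theory numFieldNormedType.Exports.

Local Open Scope classical_set_scope.
Local Open Scope ring_scope.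
Local Open Scope complex_scope.

(** * Matrices over the complex numbers *)

(* The entrywise [l^1] norm, real-valued and submultiplicative; [`|A|] is the
   maximum of the entries, with values in [R[i]]. *)
Definition mnorm (R : realType) (m n : nat) (A : 'M[R[i]]_(m, n)) : R :=
  \sum_i \sum_j ComplexField.Normc.normc (A i j).

Section MNorm.
Variable R : realType.
Local Notation C := R[i].
Local Notation normc := ComplexField.Normc.normc.

Lemma normr_normc (z : C) : `|z| = (normc z)%:C.
Proof. by rewrite normc_def; case: z. Qed.

Lemma normc_ge0 (z : C) : 0 <= normc z.
Proof. by rewrite -ler0c -normr_normc. Qed.

Lemma mnorm_ge0 m n (A : 'M[C]_(m, n)) : 0 <= mnorm A.
Proof. by apply: sumr_ge0 => i _; apply: sumr_ge0 => j _; exact: normc_ge0. Qed.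

Lemma mnorm0 m n : mnorm (0 : 'M[C]_(m, n)) = 0.
Proof.
by rewrite /mnorm big1// => i _; rewrite big1// => j _; rewrite mxE ComplexField.Normc.normc0.
Qed.

Lemma normc_le_mnorm m n (A : 'M[C]_(m, n)) i j : normc (A i j) <= mnorm A.
Proof.
rewrite /mnorm (bigD1 i)//= (bigD1 j)//= -addrA lerDl addr_ge0//.
  by apply: sumr_ge0 => ? _; exact: normc_ge0.
by apply: sumr_ge0 => ? _; apply: sumr_ge0 => ? _; exact: normc_ge0.
Qed.

Lemma mnormD m n (A B : 'M[C]_(m, n)) : mnorm (A + B) <= mnorm A + mnorm B.
Proof.
rewrite /mnorm -big_split/=; apply: ler_sum => i _.
rewrite -big_split/=; apply: ler_sum => j _.
by rewrite mxE le_normcD.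
Qed.

Lemma mnormN m n (A : 'M[C]_(m, n)) : mnorm (- A) = mnorm A.
Proof.
by apply: eq_bigr => i _; apply: eq_bigr => j _; rewrite mxE normcN.
Qed.

Lemma mnormZ m n c (A : 'M[C]_(m, n)) : mnorm (c *: A) = normc c * mnorm A.
Proof.
rewrite /mnorm mulr_sumr; apply: eq_bigr => i _.
rewrite mulr_sumr; apply: eq_bigr => j _.
by rewrite mxE ComplexField.Normc.normcM.
Qed.

Lemma mnormM m n p (A : 'M[C]_(m, n)) (B : 'M[C]_(n, p)) :
  mnorm (A *m B) <= mnorm A * mnorm B.
Proof.
have normc_sum (I : finType) (F : I -> C) : normc (\sum_i F i) <= \sum_i normc (F i).
  elim/big_ind2 : _ => //; first by rewrite ComplexField.Normc.normc0.
  by move=> x1 x2 y1 y2 h1 h2; apply: le_trans (le_normcD _ _) (lerD h1 h2).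
apply: (@le_trans _ _ (\sum_i \sum_j \sum_k normc (A i j) * normc (B j k))).
  apply: ler_sum => i _; rewrite [leRHS]exchange_big/=; apply: ler_sum => k _.
  rewrite mxE; apply: le_trans (normc_sum _ _) _; apply: ler_sum => j _.
  by rewrite ComplexField.Normc.normcM.
rewrite mulr_suml; apply: ler_sum => i _; rewrite mulr_suml; apply: ler_sum => j _.
rewrite -mulr_sumr; apply: ler_wpM2l; first exact: normc_ge0.
rewrite [leRHS](bigD1 j)//= lerDl.
by apply: sumr_ge0 => ? _; apply: sumr_ge0 => ? _; exact: normc_ge0.
Qed.

Lemma mnorm_sum m n (I : Type) (s : seq I) (P : pred I) (F : I -> 'M[C]_(m, n)) :
  mnorm (\sum_(i <- s | P i) F i) <= \sum_(i <- s | P i) mnorm (F i).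
Proof.
elim/big_ind2 : _ => //; first by rewrite mnorm0.
by move=> x1 x2 y1 y2 h1 h2; apply: le_trans (mnormD _ _) (lerD h1 h2).
Qed.

Lemma mnorm_eq0 m n (A : 'M[C]_(m, n)) : mnorm A <= 0 -> A = 0.
Proof.
move=> A0; apply/matrixP => i j; rewrite mxE.
apply: ComplexField.Normc.eq0_normc.
by apply/eqP; rewrite eq_le normc_ge0 (le_trans (normc_le_mnorm A i j) A0).
Qed.

(** The maximum norm and the [l^1] norm bound each other up to a factor depending only on the size,
    so limits of complex matrices can be estimated by real-valued functions. *)
Lemma cvg_mnorm m n (T : Type) (F : set_system T) (FF : Filter F)
    (f : T -> 'M[C]_(m, n)) (l : 'M[C]_(m, n)) :
  f @ F --> l <-> mnorm (f x - l) @[x --> F] --> (0 : R).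
Proof.
split => [/cvgrPdist_lt fl|/cvgrPdist_lt fl].
- apply/cvgrPdist_lt => e e0.
  (* A sum of [m * n] terms at most [d] stays strictly below [e]; the successor also covers empty
     matrices. *)
  pose d : R := e / (m * n).+1%:R.
  have d0 : 0 < d by rewrite divr_gt0.
  have d0' : (0 : C) < d%:C by rewrite ltcR.
  apply: filterS (fl _ d0') => x lx.
  rewrite sub0r normrN ger0_norm ?mnorm_ge0//.
  apply: (@le_lt_trans _ _ (\sum_(i < m) \sum_(j < n) d)).
    apply: ler_sum => i _; apply: ler_sum => j _.
    rewrite -lecR -normr_normc; apply: ltW; apply: le_lt_trans lx.
    rewrite distrC [leRHS]/Num.norm /= mx_normE [leLHS]nngE num_le.
    exact: (le_bigmax _ (fun ij : 'I_m * 'I_n => `|(f x - l) ij.1 ij.2|%:nng) (i, j)).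
  rewrite !sumr_const !card_ord -mulrnA -[_ *+ _]mulr_natr /d mulrAC.
  by rewrite ltr_pdivrMr// ltr_pM2l// ltr_nat mulnC.
- apply/cvgrPdist_lt => e e0.
  have [d eR] : exists d : R, e = d%:C by exact/complex_realP/gtr0_real.
  have e0' : 0 < d by rewrite -ltcR -eR.
  apply: filterS (fl _ e0') => x.
  rewrite sub0r normrN ger0_norm ?mnorm_ge0// => lx.
  rewrite eR distrC [X in X < _]/Num.norm /=.
  have [->|/mx_norm_neq0[ij ->]] := eqVneq (mx_norm (f x - l)) 0.
    by rewrite ltcR.
  by rewrite normr_normc ltcR; apply: le_lt_trans lx; exact: normc_le_mnorm.
Qed.

Lemma cvg_mnorm_le m n (T : Type) (F : set_system T) (FF : Filter F)
    (f : T -> 'M[C]_(m, n)) (l : 'M[C]_(m, n)) (u : T -> R) :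
  (\forall x \near F, mnorm (f x - l) <= u x) -> u @ F --> (0 : R) -> f @ F --> l.
Proof.
move=> fu u0; apply/cvg_mnorm.
apply: squeeze_cvgr u0; last exact: cvg_cst.
by apply: filterS fu => x ->; rewrite mnorm_ge0.
Qed.

Lemma hausdorff_mx m n : hausdorff_space 'M[C]_(m, n).
Proof. exact: (@norm_hausdorff C). Qed.

Lemma cvg_mulmx m n p (T : Type) (F : set_system T) (FF : Filter F)
    (f : T -> 'M[C]_(m, n)) (g : T -> 'M[C]_(n, p)) (l : 'M[C]_(m, n)) (l' : 'M[C]_(n, p)) :
  f @ F --> l -> g @ F --> l' -> f x *m g x @[x --> F] --> l *m l'.
Proof.
move=> /cvg_mnorm fl /cvg_mnorm gl.
apply: (@cvg_mnorm_le _ _ _ _ _ _ _ (fun x => mnorm (f x - l) * mnorm (g x - l') +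
   mnorm l * mnorm (g x - l') + mnorm (f x - l) * mnorm l')).
  apply: nearW => x.
  have -> : f x *m g x - l *m l' = (f x - l) *m (g x - l') + l *m (g x - l') + (f x - l) *m l'.
    by rewrite -mulmxDl subrK mulmxBr mulmxBl addrA subrK.
  apply: le_trans (mnormD _ _) _; apply: lerD; last exact: mnormM.
  by apply: le_trans (mnormD _ _) _; apply: lerD; exact: mnormM.
have -> : (0 : R) = 0 * 0 + mnorm l * 0 + 0 * mnorm l' by rewrite !(mulr0, mul0r, addr0).
by apply: cvgD; [apply: cvgD; apply: cvgM|apply: cvgM] => //; exact: cvg_cst.
Qed.

Lemma cvg_sumr (I : finType) (T : Type) (F : set_system T) (FF : Filter F)
    (f : I -> T -> R) :
  (forall i, f i x @[x --> F] --> (0 : R)) -> \sum_i f i x @[x --> F] --> (0 : R).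
Proof.
move=> f0; rewrite -[X in _ --> X](_ : \sum_(i : I) 0 = _); last by rewrite big1.
by apply: cvg_big => // x; exact: add_continuous.
Qed.

(** Weierstrass test: the real and imaginary parts of every entry are dominated by [b], so their
    series converge absolutely. *)
Lemma is_cvg_series_mx m n (u : nat -> 'M[C]_(m, n)) (b : nat -> R) :
  (forall k, mnorm (u k) <= b k) -> cvgn (series b) -> cvgn (series u).
Proof.
move=> ub cb.
pose re i j k := complex.Re (u k i j : C); pose im i j k := complex.Im (u k i j : C).
have cvgub (v : nat -> R) i j : (forall k, `|v k| <= normc (u k i j)) -> cvgn (series v).
  move=> vu; apply: (@normed_cvg R R^o _ _); apply: series_le_cvg cb => k //=.
    by apply: le_trans (ub k); exact: mnorm_ge0.
  by apply: le_trans (vu k) _; apply: le_trans (ub k); exact: normc_le_mnorm.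
have cre i j : cvgn (series (re i j)).
  by apply: (cvgub _ i j) => k; rewrite -lecR -normr_normc; exact: normc_ge_Re.
have cim i j : cvgn (series (im i j)).
  (* Up to sign, the imaginary part is the real part of the product with the imaginary unit, which
     has modulus [1]. *)
  apply: (cvgub _ i j) => k; rewrite /im -normrN -ReiNIm -lecR.
  apply: le_trans (normc_ge_Re _) _; rewrite normrM !normr_normc -rmorphM lecR.
  by rewrite -[X in _ <= X]mulr1 /= !expr0n/= expr1n add0r sqrtr1.
apply/cvg_ex.
exists (\matrix_(i, j) (limn (series (re i j)) +i* limn (series (im i j)))).
apply/cvg_mnorm.
pose D i j N := series (re i j) N - limn (series (re i j)).
pose E i j N := series (im i j) N - limn (series (im i j)).
have subr_lim (v : nat -> R) : cvgn v -> v N - limn v @[N --> \oo] --> 0.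
  by move=> cv; rewrite -[X in _ --> X](subrr (limn v)); apply: cvgB => //; exact: cvg_cst.
have D0 i j : D i j N @[N --> \oo] --> 0 by exact: subr_lim.
have E0 i j : E i j N @[N --> \oo] --> 0 by exact: subr_lim.
rewrite [X in X @ _ --> _](_ : _ =
    fun N => \sum_i \sum_j normc (D i j N +i* E i j N)); last first.
  apply/funext => N; apply: eq_bigr => i _; apply: eq_bigr => j _; congr normc.
  rewrite !mxE /D /E /series /= summxE.
  have -> : \sum_(0 <= k < N) u k i j =
      (\sum_(0 <= k < N) re i j k) +i* (\sum_(0 <= k < N) im i j k).
    by elim/big_rec3 : _ => // k x y z _ ->; rewrite /re /im; case: (u k i j).
  by [].
apply: cvg_sumr => i; apply: cvg_sumr => j.
have -> : (0 : R) = normc ((0 : R) +i* (0 : R)) by rewrite /= expr0n/= addr0 sqrtr0.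
rewrite /=.
apply: continuous_cvg; first exact: sqrt_continuous.
by apply: cvgD; apply: cvgM.
Qed.

End MNorm.

(** * The matrix exponential *)

Section Expm.
Variable R : realType.
Local Notation C := R[i].
Local Notation normc := ComplexField.Normc.normc.

Definition expm_coeff n (A : 'M[C]_n) : nat -> 'M[C]_n :=
  fun k => k`!%:R^-1 *: A ^+ k.

Lemma normc_natV k : normc (k%:R^-1 : C) = k%:R^-1.
Proof.
apply: complexI; rewrite -normr_normc normfV normr_nat.
by rewrite fmorphV rmorph_nat.
Qed.

(** The constant is forced by [k = 0], because the [l^1] norm of the identity is [n] and not [1]. *)
Lemma mnorm_exp n (A : 'M[C]_n) k :
  mnorm (A ^+ k) <= mnorm (1%:M : 'M[C]_n) * mnorm A ^+ k.
Proof.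
elim: k => [|k IH]; first by rewrite !expr0 mulr1.
rewrite exprSr -mulmxE; apply: le_trans (mnormM _ _) _.
by rewrite exprSr mulrA ler_wpM2r// mnorm_ge0.
Qed.

(** For positive exponents the induction starts at [A] itself and the constant disappears, as the
    remainder estimate for [expm] requires. *)
Lemma mnorm_expS n (A : 'M[C]_n) k : mnorm (A ^+ k.+1) <= mnorm A ^+ k.+1.
Proof.
elim: k => [|k IH]; first by rewrite !expr1.
rewrite exprSr -mulmxE; apply: le_trans (mnormM _ _) _.
by rewrite [leRHS]exprSr ler_wpM2r// mnorm_ge0.
Qed.

Lemma mnorm_expm_coeff n (A : 'M[C]_n) k :
  mnorm (expm_coeff A k) <= mnorm (1%:M : 'M[C]_n) * exp_coeff (mnorm A) k.
Proof.
rewrite mnormZ normc_natV /exp_coeff /= mulrC mulrA ler_wpM2r ?invr_ge0//.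
exact: mnorm_exp.
Qed.

Lemma is_cvg_expm n (A : 'M[C]_n) : cvgn (series (expm_coeff A)).
Proof.
apply: (is_cvg_series_mx (mnorm_expm_coeff A)).
rewrite (_ : (fun _ => _) = (mnorm (1%:M : 'M[C]_n) *: exp_coeff (mnorm A))); last exact/funext.
by apply: is_cvg_seriesZ; exact: is_cvg_series_exp_coeff.
Qed.

Lemma expm_cvg n (A : 'M[C]_n) : series (expm_coeff A) N @[N --> \oo] --> expm A.
Proof. exact: is_cvg_expm. Qed.

Lemma expm_lim n (A L : 'M[C]_n) :
  series (expm_coeff A) N @[N --> \oo] --> L -> expm A = L.
Proof. by move=> /(cvg_lim (@hausdorff_mx R n n)). Qed.

Lemma cvg_mx_unique m n (T : Type) (F : set_system T) (FF : ProperFilter F)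
    (f : T -> 'M[C]_(m, n)) (l l' : 'M[C]_(m, n)) :
  f x @[x --> F] --> l -> f x @[x --> F] --> l' -> l = l'.
Proof. by move=> fl fl'; apply: (cvg_unique (@hausdorff_mx R m n) fl fl'). Qed.

(** The relation passes to powers, partial sums and limits. [X] may be rectangular: with a row or a
    column it describes the action on eigenvectors. *)
Lemma expm_intertwine m n (A : 'M[C]_m) (B : 'M[C]_n) (X : 'M[C]_(m, n)) :
  A *m X = X *m B -> expm A *m X = X *m expm B.
Proof.
move=> AX.
have hk k : A ^+ k *m X = X *m B ^+ k.
  elim: k => [|k IH]; first by rewrite !expr0 mulmx1 mul1mx.
  by rewrite exprS -mulmxE -mulmxA IH mulmxA AX -mulmxA mulmxE -exprS.
have e N : series (expm_coeff A) N *m X = X *m series (expm_coeff B) N.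
  rewrite /series /= mulmx_suml mulmx_sumr; apply: eq_bigr => k _.
  by rewrite -scalemxAl hk scalemxAr.
have h1 : series (expm_coeff A) N *m X @[N --> \oo] --> expm A *m X.
  by apply: cvg_mulmx; [exact: expm_cvg|exact: cvg_cst].
have h2 : X *m series (expm_coeff B) N @[N --> \oo] --> X *m expm B.
  by apply: cvg_mulmx; [exact: cvg_cst|exact: expm_cvg].
apply: (@cvg_mx_unique _ _ _ _ _ _ _ _ h1).
by under eq_fun do rewrite e.
Qed.

(** Compares a product of partial sums with the partial sum of the Cauchy product: removing the
    triangle [i + j < N] from a square of indices leaves the opposite corner. *)
Lemma triangle_sum (V : zmodType) N (F : nat -> nat -> V) :
  (\sum_(0 <= j < N) \sum_(0 <= i < N) F i j) -
  \sum_(0 <= k < N) \sum_(0 <= j < k.+1) F (k - j)%N j =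
  \sum_(0 <= j < N) \sum_(N - j <= i < N) F i j.
Proof.
have -> : \sum_(0 <= k < N) \sum_(0 <= j < k.+1) F (k - j)%N j =
          \sum_(0 <= j < N) \sum_(0 <= i < N - j) F i j.
  have -> : \sum_(0 <= k < N) \sum_(0 <= j < k.+1) F (k - j)%N j =
    \sum_(0 <= k < N) \sum_(0 <= j < N | (j <= k)%N) F (k - j)%N j.
    rewrite !big_nat; apply: eq_bigr => k /= kN.
    by rewrite (big_nat_widen _ _ N)//.
  rewrite (exchange_big_dep_nat xpredT)//=.
  rewrite !big_nat; apply: eq_bigr => j /= jN.
  transitivity (\sum_(j <= k < N) F (k - j)%N j).
    by rewrite [RHS](big_nat_widenl _ 0%N).
  rewrite -{1}[j]add0n big_addn; apply: eq_bigr => i _.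
  by rewrite addnK.
rewrite -sumrB; apply: eq_bigr => j _.
by rewrite (@big_cat_nat _ _ _ (N - j) 0 N)//= ?leq_subr// addrC addrK.
Qed.

Lemma expm_coeffD n (A B : 'M[C]_n) k : A *m B = B *m A ->
  expm_coeff (A + B) k =
  \sum_(0 <= j < k.+1) expm_coeff A (k - j) *m expm_coeff B j.
Proof.
move=> AB; rewrite /expm_coeff exprDn_comm// scaler_sumr big_mkord.
apply: eq_bigr => j _; rewrite -[RHS]scalemxAl -[X in _ = _ *: X]scalemxAr [RHS]scalerA mulmxE.
rewrite -[X in _ *: X]scaler_nat scalerA; congr (_ *: _).
have jk : (j <= k)%N by rewrite -ltnS.
rewrite -(bin_fact jk) !natrM !invfM mulrAC mulVf ?mul1r; last first.
  by rewrite pnatr_eq0 -lt0n bin_gt0.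
by rewrite mulrC.
Qed.

Lemma exp_coeffD (a b : R) k :
  exp_coeff (a + b) k = \sum_(0 <= j < k.+1) exp_coeff a (k - j)%N * exp_coeff b j.
Proof.
rewrite /exp_coeff /= exprDn mulr_suml big_mkord; apply: eq_bigr => j _.
have jk : (j <= k)%N by rewrite -ltnS.
rewrite [RHS]mulrACA -mulr_natr. rewrite -[LHS]mulrA; congr (_ * _).
rewrite -(bin_fact jk) !natrM !invfM mulVKf; last first.
  by rewrite pnatr_eq0 -lt0n bin_gt0.
by rewrite mulrC.
Qed.

(* The defect of [exp A exp B = exp (A + B)] on partial sums is dominated
   termwise by the defect of the real series at the norms, which tends to [0]. *)
Lemma mnorm_expm_defect n (A B : 'M[C]_n) N : A *m B = B *m A ->
  mnorm (series (expm_coeff A) N *m series (expm_coeff B) N -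
         series (expm_coeff (A + B)) N) <=
  mnorm (1%:M : 'M[C]_n) ^+ 2 *
  (series (exp_coeff (mnorm A)) N * series (exp_coeff (mnorm B)) N -
   series (exp_coeff (mnorm A + mnorm B)) N).
Proof.
move=> AB; rewrite /series /=.
have -> : \sum_(0 <= k < N) expm_coeff (A + B) k =
    \sum_(0 <= k < N) \sum_(0 <= j < k.+1) expm_coeff A (k - j) *m expm_coeff B j.
  by apply: eq_bigr => k _; exact: expm_coeffD.
have -> : \sum_(0 <= k < N) exp_coeff (mnorm A + mnorm B) k =
    \sum_(0 <= k < N) \sum_(0 <= j < k.+1)
      exp_coeff (mnorm A) (k - j)%N * exp_coeff (mnorm B) j.
  by apply: eq_bigr => k _; exact: exp_coeffD.
have -> : (\sum_(0 <= k < N) expm_coeff A k) *m (\sum_(0 <= k < N) expm_coeff B k) =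
    \sum_(0 <= j < N) \sum_(0 <= i < N) expm_coeff A i *m expm_coeff B j.
  by rewrite mulmx_sumr; apply: eq_bigr => j _; rewrite mulmx_suml.
have -> : (\sum_(0 <= k < N) exp_coeff (mnorm A) k) * (\sum_(0 <= k < N) exp_coeff (mnorm B) k) =
    \sum_(0 <= j < N) \sum_(0 <= i < N) exp_coeff (mnorm A) i * exp_coeff (mnorm B) j.
  by rewrite mulr_sumr; apply: eq_bigr => j _; rewrite mulr_suml.
rewrite (triangle_sum N (fun i j => expm_coeff A i *m expm_coeff B j)).
rewrite (triangle_sum N (fun i j => exp_coeff (mnorm A) i * exp_coeff (mnorm B) j)).
apply: le_trans (mnorm_sum _ _ _) _; rewrite mulr_sumr; apply: ler_sum => j _.
apply: le_trans (mnorm_sum _ _ _) _; rewrite mulr_sumr; apply: ler_sum => i _.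
apply: le_trans (mnormM _ _) _; rewrite expr2 mulrACA.
by apply: ler_pM; rewrite ?mnorm_ge0//; exact: mnorm_expm_coeff.
Qed.

Lemma expmD n (A B : 'M[C]_n) : A *m B = B *m A ->
  expm (A + B) = expm A *m expm B.
Proof.
move=> AB; apply: expm_lim.
pose d N := series (expm_coeff A) N *m series (expm_coeff B) N.
have h1 : d N @[N --> \oo] --> expm A *m expm B.
  by apply: cvg_mulmx; exact: expm_cvg.
(* The limit vanishes by [expRD]: the convergence of the Cauchy product is borrowed from the real
   exponential. *)
have h2 : (series (exp_coeff (mnorm A)) N * series (exp_coeff (mnorm B)) N -
   series (exp_coeff (mnorm A + mnorm B)) N) @[N --> \oo] --> (0 : R).
  rewrite -[X in _ --> X](subrr (expR (mnorm A + mnorm B))) {1}expRD.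
  by apply: cvgB; [apply: cvgM|]; exact: is_cvg_series_exp_coeff.
move/cvg_mnorm in h1.
apply: (@cvg_mnorm_le _ _ _ _ _ _ _ _ (fun N => mnorm (1%:M : 'M[C]_n) ^+ 2 *
  (series (exp_coeff (mnorm A)) N * series (exp_coeff (mnorm B)) N -
   series (exp_coeff (mnorm A + mnorm B)) N) + mnorm (d N - expm A *m expm B))).
- apply: nearW => N.
  apply: le_trans (lerD (mnorm_expm_defect N AB) (lexx _)).
  rewrite -[mnorm (_ - series _ _)]mnormN opprB.
  by apply: le_trans (mnormD _ _); rewrite addrA subrK.
- rewrite -[X in _ --> X](addr0 0) -{1}(mulr0 (mnorm (1%:M : 'M[C]_n) ^+ 2)).
  by apply: cvgD => //; apply: cvgM => //; exact: cvg_cst.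
Qed.

Lemma expm0 n : expm (0 : 'M[C]_n) = 1%:M.
Proof.
apply: expm_lim; rewrite -(cvg_shiftS (series (expm_coeff (0 : 'M[C]_n)))) /=.
rewrite (_ : (fun N => _) = cst (1%:M)); first exact: cvg_cst.
apply/funext => N; rewrite /series /= big_nat_recl// big1.
  by rewrite addr0 /expm_coeff fact0 invr1 scale1r expr0.
by move=> k _; rewrite /expm_coeff expr0n scaler0.
Qed.

Lemma expmNl n (A : 'M[C]_n) : expm (- A) *m expm A = 1%:M.
Proof. by rewrite -expmD ?addNr ?expm0// mulmxN mulNmx. Qed.

Lemma mnorm_lim_le m n (u : nat -> 'M[C]_(m, n)) (l c : 'M[C]_(m, n)) (b : nat -> R) (b' : R) :
  u N @[N --> \oo] --> l -> (\forall N \near \oo, mnorm (u N - c) <= b N) ->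
  b N @[N --> \oo] --> b' -> mnorm (l - c) <= b'.
Proof.
move=> /cvg_mnorm ul ub bb.
have h : (mnorm (u N - l) + b N) @[N --> \oo] --> b'.
  by rewrite -[X in _ --> X]add0r; exact: cvgD.
apply: (cvgr_to_ge h).
apply: filterS ub => N ubN; apply: le_trans (lerD (lexx _) ubN).
 rewrite -[mnorm (u N - l)]mnormN opprB.
by apply: le_trans (mnormD _ _); rewrite addrA subrK.
Qed.

(** Both sides are the tails from degree [2] on, and these are compared term by term. *)
Lemma mnorm_expm_remainder n (A : 'M[C]_n) :
  mnorm (expm A - (1%:M + A)) <= expR (mnorm A) - (1 + mnorm A).
Proof.
apply: (mnorm_lim_le (@expm_cvg _ A)
  (b := fun N => series (exp_coeff (mnorm A)) N - (1 + mnorm A))).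
- exists 2 => // N /= N2; rewrite -(subnK N2) /series /=.
  (* The splitting is rewritten twice, since one rewrite serves only one of the two sums, the matrix
     one or the real one. *)
  have -> (V : zmodType) (F : nat -> V) k : \sum_(0 <= i < k + 2) F i =
     F 0%N + F 1%N + \sum_(0 <= i < k) F i.+2.
    by rewrite addn2 2?big_nat_recl// addrA.
  have -> (V : zmodType) (F : nat -> V) k : \sum_(0 <= i < k + 2) F i =
     F 0%N + F 1%N + \sum_(0 <= i < k) F i.+2.
    by rewrite addn2 2?big_nat_recl// addrA.
  have -> : expm_coeff A 0 = 1%:M by rewrite /expm_coeff fact0 expr0 invr1 scale1r.
  have -> : expm_coeff A 1 = A by rewrite /expm_coeff expr1 invr1 scale1r.
  have -> : exp_coeff (mnorm A) 0 = 1 by rewrite /exp_coeff /= fact0 expr0 divr1.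
  have -> : exp_coeff (mnorm A) 1 = mnorm A by rewrite /exp_coeff /= expr1 divr1.
  rewrite [X in mnorm X]addrAC subrr add0r [leRHS]addrAC subrr add0r.
  apply: le_trans (mnorm_sum _ _ _) _; apply: ler_sum => k _.
  rewrite mnormZ normc_natV mulrC ler_wpM2r ?invr_ge0//.
  exact: mnorm_expS.
- by apply: cvgB; [exact: is_cvg_series_exp_coeff|exact: cvg_cst].
Qed.

End Expm.

(** * The complex exponential *)

Section ExpC.
Variable R : realType.
Local Notation C := R[i].
Local Notation normc := ComplexField.Normc.normc.

Lemma cvg_normc (T : Type) (F : set_system T) (FF : Filter F) (f : T -> C) (l : C) :
  f @ F --> l <-> normc (f x - l) @[x --> F] --> (0 : R).
Proof.
split => [/cvgrPdist_lt fl|/cvgrPdist_lt fl].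
- apply/cvgrPdist_lt => e e0.
  have e0' : (0 : C) < e%:C by rewrite ltcR.
  apply: filterS (fl _ e0') => x; rewrite distrC normr_normc ltcR.
  by rewrite sub0r normrN ger0_norm ?normc_ge0.
- apply/cvgrPdist_lt => e e0.
  have [d eR] : exists d : R, e = d%:C by exact/complex_realP/gtr0_real.
  have e0' : 0 < d by rewrite -ltcR -eR.
  apply: filterS (fl _ e0') => x; rewrite sub0r normrN ger0_norm ?normc_ge0//.
  by rewrite eR distrC normr_normc ltcR.
Qed.

Lemma normc_leD (x y : R) : normc (x +i* y) <= `|x| + `|y|.
Proof.
have -> : x +i* y = x +i* 0 + 0 +i* y by simpc.
apply: le_trans (le_normcD _ _) _.
by rewrite /= expr0n/= addr0 add0r !sqrtr_sqr.
Qed.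

Lemma cvg_complex (T : Type) (F : set_system T) (FF : Filter F) (f g : T -> R) (a b : R) :
  f @ F --> a -> g @ F --> b -> (f x +i* g x) @[x --> F] --> a +i* b.
Proof.
move=> fa gb; apply/cvg_normc.
have h : `|f x - a| + `|g x - b| @[x --> F] --> (0 : R).
  have d (u : T -> R) (l : R) : u @ F --> l -> `|u x - l| @[x --> F] --> (0 : R).
    move=> ul; rewrite -(normr0 R) -(subrr l); apply: cvg_norm.
    by apply: cvgB => //; exact: cvg_cst.
  by rewrite -[X in _ --> X](addr0 0); apply: cvgD; exact: d.
apply: squeeze_cvgr h; last exact: cvg_cst.
by apply: nearW => x; rewrite normc_ge0 (normc_leD (f x - a) (g x - b)).
Qed.

Lemma hausdorffC : hausdorff_space C.
Proof. exact: (@norm_hausdorff C C). Qed.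

Lemma expC_lim (z l : C) :
  series (fun k => z ^+ k / k`!%:R) N @[N --> \oo] --> l -> expC z = l.
Proof. by move=> /(cvg_lim hausdorffC). Qed.

(** Through [1 x 1] matrices, [expC] inherits the addition formula from [expm]. *)
Lemma expm_scalar1 (z : C) : expm (z%:M : 'M[C]_1) = (expC z)%:M.
Proof.
rewrite [LHS]mx11_scalar; apply: (congr1 scalar_mx); apply/esym/expC_lim/cvg_normc.
have /cvg_mnorm h := @expm_cvg R 1 z%:M.
apply: squeeze_cvgr h; last exact: cvg_cst.
apply: nearW => N; rewrite normc_ge0/=.
apply: le_trans (normc_le_mnorm _ 0 0); rewrite mxE [in leRHS]mxE.
rewrite [X in _ <= normc (X - _)](_ : _ = series (fun k => z ^+ k / k`!%:R) N)//.
rewrite /series /= summxE; apply: eq_bigr => k _.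
by rewrite /expm_coeff -rmorphXn /= !mxE eqxx mulr1n mulrC.
Qed.

(** Each basis row intertwines the [1 x 1] scalar matrix with the [n x n] one. *)
Lemma expm_scalar n (z : C) : expm (z%:M : 'M[C]_n) = (expC z)%:M.
Proof.
apply/row_matrixP => i; rewrite rowE [RHS]rowE.
rewrite -(@expm_intertwine _ _ _ (z%:M : 'M[C]_1)); last first.
  by rewrite mul_scalar_mx mul_mx_scalar.
by rewrite expm_scalar1 mul_scalar_mx mul_mx_scalar.
Qed.

Lemma expCD (z w : C) : expC (z + w) = expC z * expC w.
Proof.
have := @expmD _ 1 (z%:M) (w%:M) (scalar_mxC _ _).
rewrite -raddfD !expm_scalar1 -scalar_mxM => /matrixP /(_ 0 0).
by rewrite !mxE.
Qed.

Lemma expC0 : expC (0 : C) = 1.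
Proof.
have := @expm_scalar1 0; rewrite raddf0 expm0 => /matrixP /(_ 0 0).
by rewrite !mxE.
Qed.

Lemma expC_neq0 (z : C) : expC z != 0.
Proof.
apply/eqP => z0; have := expCD z (- z).
by rewrite subrr expC0 z0 mul0r => /eqP; rewrite oner_eq0.
Qed.

Lemma expCN (z : C) : expC (- z) = (expC z)^-1.
Proof.
by apply: (mulfI (expC_neq0 z)); rewrite -expCD subrr expC0 mulfV// expC_neq0.
Qed.

Lemma expC_real (x : R) : expC (x%:C) = (expR x)%:C.
Proof.
apply: expC_lim; rewrite (_ : (fun N => _) = fun N => (series (exp_coeff x) N +i* 0)); last first.
  apply/funext => N; rewrite -[RHS]/((series (exp_coeff x) N)%:C) /series /= rmorph_sum/=.
  apply: eq_bigr => k _.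
  by rewrite /exp_coeff /= rmorphM rmorphXn fmorphV rmorph_nat.
by apply: cvg_complex; [exact: is_cvg_series_exp_coeff|exact: cvg_cst].
Qed.

Lemma expC_imag (y : R) : expC (0 +i* y) = cos y +i* sin y.
Proof.
(* The powers of the imaginary unit are written in the shape of [cos_coeff] and [sin_coeff]. At
   [k = 0] the truncated predecessor is harmless, because its factor [(odd k)%:R] is [0]. *)
have iX k : (0 +i* 1 : C) ^+ k =
    ((~~ odd k)%:R * (-1) ^+ k./2) +i* ((odd k)%:R * (-1) ^+ k.-1./2).
  rewrite -[in LHS](odd_double_half k) exprD -muln2 mulnC exprM sqr_i.
  have -> : (-1 : C) ^+ k./2 = ((-1) ^+ k./2)%:C by rewrite rmorphXn rmorphN1.
  have [ok|ok] := boolP (odd k).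
    have -> : k.-1./2 = k./2 by rewrite -{1}(odd_double_half k) ok add1n /= doubleK.
    rewrite ?ok /= ?expr1 ?mul0r ?mul1r. by simpc.
  by rewrite /= expr0 ?mul0r ?mul1r.
apply: expC_lim.
rewrite (_ : (fun N => _) =
    fun N => (series (cos_coeff y) N +i* series (sin_coeff y) N)); last first.
  apply/funext => N.
  have -> : series (cos_coeff y) N +i* series (sin_coeff y) N =
      \sum_(0 <= k < N) (cos_coeff y k +i* sin_coeff y k).
    rewrite /series /=; elim/big_rec3 : _ => // k a b c _ <-; by simpc.
  apply: eq_bigr => k _.
  have -> : 0 +i* y = (0 +i* 1) * y%:C by simpc.
  have -> : (k`!%:R^-1 : C) = (k`!%:R^-1 : R)%:C by rewrite fmorphV rmorph_nat.
  rewrite exprMn iX -rmorphXn /cos_coeff /sin_coeff /=; simpc.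
  by rewrite -!mulrA.
rewrite cos.unlock sin.unlock.
by apply: cvg_complex; [exact: is_cvg_series_cos_coeff|exact: is_cvg_series_sin_coeff].
Qed.

(** Polar form: the modulus is a real exponential, and the unit factor [a +i* b] has argument
    [acos a] or its opposite, according to the sign of [b], since the sine of [acos a] is
    nonnegative. *)
Lemma expC_surj (z : C) : z != 0 -> exists w, expC w = z.
Proof.
move=> z0.
have n0 : 0 < normc z by rewrite -ltcR -normr_normc normr_gt0.
have [x xE] := expR_total n0.
have [u uE] : exists u : C, u = z / (normc z)%:C by exists (z / (normc z)%:C).
suff [y yE] : exists y : R, cos y +i* sin y = u.
  exists (x%:C + 0 +i* y); rewrite expCD expC_real expC_imag xE yE uE mulrC divfK//.
  by rewrite -normr_normc normr_eq0.
have : normc u = 1.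
  by apply: complexI; rewrite -[LHS]normr_normc uE -normr_normc normf_div normr_id divff ?normr_eq0.
case: u {uE} => a b /= ab1.
have ab : a ^+ 2 + b ^+ 2 = 1.
  by rewrite -[LHS]sqr_sqrtr ?ab1 ?expr1n// addr_ge0// sqr_ge0.
have a1 : -1 <= a <= 1.
  by rewrite -ler_norml -(@expr_le1 _ 2)// real_normK ?num_real// -ab lerDl sqr_ge0.
have sE : sin (acos a) = `|b|.
  by rewrite sin_acos// -ab addrC addKr sqrtr_sqr.
have cE : cos (acos a) = a by apply: acosK; rewrite in_itv.
have [b0|b0] := leP 0 b.
  by exists (acos a); rewrite cE sE ger0_norm.
by exists (- acos a); rewrite cosN sinN cE sE ltr0_norm// opprK.
Qed.

End ExpC.

(** * One-parameter subgroups *)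

Section OneParam.
Variable R : realType.
Local Notation C := R[i].
Local Notation normc := ComplexField.Normc.normc.

(** From [expR (- y) >= 1 - y] one gets [expR y * (1 - y) <= 1]. Hence the left side times [1 - y]
    is at most [y ^+ 2], and [1 - y] is at least [1/2]. *)
Lemma expR_remainder (y : R) : 0 <= y <= 2^-1 -> expR y - (1 + y) <= 2 * y ^+ 2.
Proof.
move=> /andP[y0 y1].
have h : expR y * (1 - y) <= 1.
  rewrite -ler_pdivlMl ?expR_gt0// mulr1 -expRN.
  exact: expR_ge1Dx.
have z : 0 < 1 - y by lra.
rewrite -(ler_pM2r z); apply: (@le_trans _ _ (y ^+ 2)); nra.
Qed.

Lemma cvg_normc_dnbhs0 : normc h @[h --> (0 : C)^'] --> (0 : R).
Proof.
apply/cvgrPdist_lt => e e0.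
have e0' : (0 : C) < e%:C by rewrite ltcR.
have := @dnbhs0_lt C C _ e0'; apply: filterS => h.
by rewrite normr_normc ltcR sub0r normrN ger0_norm ?normc_ge0.
Qed.

Lemma cvg_of_quotient m n (f : C -> 'M[C]_(m, n)) (l X : 'M[C]_(m, n)) :
  h^-1 *: (f h - l) @[h --> (0 : C)^'] --> X -> f h @[h --> (0 : C)^'] --> l.
Proof.
move=> /cvg_mnorm fX.
apply: (@cvg_mnorm_le _ _ _ _ _ _ _ _ (fun h => normc h *
    (mnorm (h^-1 *: (f h - l) - X) + mnorm X))).
  near=> h.
  have hn : h != 0 by near: h; exact: nbhs_dnbhs_neq.
  have fh : f h - l = h *: (h^-1 *: (f h - l)) by rewrite scalerA mulfV// scale1r.
  rewrite [X in mnorm X <= _]fh mnormZ ler_wpM2l ?normc_ge0//.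
  by apply: le_trans (mnormD _ _); rewrite subrK.
rewrite -[X in _ --> X](mul0r (0 + mnorm X)); apply: cvgM.
  exact: cvg_normc_dnbhs0.
by apply: cvgD; [exact: fX|exact: cvg_cst].
Unshelve. all: by end_near. Qed.

Lemma cvg_affine m n (M N : 'M[C]_(m, n)) (c : C -> 'M[C]_(m, n)) :
  (forall h, c h = h *: M + N) -> h^-1 *: (c h - N) @[h --> (0 : C)^'] --> M.
Proof.
move=> cE; apply: cvg_near_cst; near=> h.
rewrite cE addrK scalerA mulVf ?scale1r//.
by near: h; exact: nbhs_dnbhs_neq.
Unshelve. all: by end_near. Qed.

Lemma expm_deriv0 n (X : 'M[C]_n) :
  h^-1 *: (expm (h *: X) - 1%:M) @[h --> (0 : C)^'] --> X.
Proof.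
pose x := mnorm X.
apply: (@cvg_mnorm_le _ _ _ _ _ _ _ _ (fun h => normc h * (2 * x ^+ 2))).
(* Within this radius [mnorm (h *: X)] is at most [1/2], the range of [expR_remainder]. With [x] in
   place of [x + 1] the radius would be [0] for [X = 0]. *)
- have b0 : 0 < (2 * (x + 1))^-1 :> R by rewrite invr_gt0 mulr_gt0// ltr_wpDl// mnorm_ge0.
  have b0' : (0 : C) < ((2 * (x + 1))^-1)%:C by rewrite ltcR.
  have h0 := @dnbhs0_lt C C _ b0'.
  near=> h.
  have hb : normc h < (2 * (x + 1))^-1 by rewrite -ltcR -normr_normc; near: h.
  have hn : h != 0 by near: h; exact: nbhs_dnbhs_neq.
  have nh : 0 < normc h by rewrite -ltcR -normr_normc normr_gt0.
  have -> : h^-1 *: (expm (h *: X) - 1%:M) - X = h^-1 *: (expm (h *: X) - (1%:M + h *: X)).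
    by rewrite opprD addrA [in RHS]scalerBr scalerA mulVf// scale1r.
  rewrite mnormZ ComplexField.Normc.normcV mulrC ler_pdivrMr//.
  apply: le_trans (mnorm_expm_remainder _) _; rewrite mnormZ -/x.
  have -> : normc h * (2 * x ^+ 2) * normc h = 2 * (normc h * x) ^+ 2 by rewrite exprMn; lra.
  have x0 : 0 <= x by exact: mnorm_ge0.
  apply: expR_remainder; rewrite mulr_ge0 ?normc_ge0//=.
  apply: le_trans (ler_wpM2r x0 (ltW hb)) _.
  rewrite mulrC ler_pdivrMr; nra.
- rewrite -[X in _ --> X](mul0r (2 * x ^+ 2)); apply: cvgM; last exact: cvg_cst.
  exact: cvg_normc_dnbhs0.
Unshelve. all: by end_near. Qed.

(** The factor [1%:M + e] is expanded before norms are taken, so that the norm [n] of the identity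
    does not enter. *)
Lemma mnorm_exp1D n (e : 'M[C]_n) k :
  mnorm ((1%:M + e) ^+ k - 1%:M) <= (1 + mnorm e) ^+ k - 1.
Proof.
elim: k => [|k IH]; first by rewrite !expr0 !subrr mnorm0.
have -> : (1%:M + e) ^+ k.+1 - 1%:M = (1%:M + e) *m ((1%:M + e) ^+ k - 1%:M) + e.
  by rewrite mulmxBr mulmx1 mulmxE -exprS opprD addrA subrK.
have -> : (1 + mnorm e) ^+ k.+1 - 1 =
    ((1 + mnorm e) ^+ k - 1) + mnorm e * ((1 + mnorm e) ^+ k - 1) + mnorm e.
  rewrite exprS; lra.
apply: le_trans (mnormD _ _) _; rewrite lerD2r mulmxDl mul1mx.
apply: le_trans (mnormD _ _) _; apply: lerD => //.
by apply: le_trans (mnormM _ _) _; rewrite ler_wpM2l// mnorm_ge0.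
Qed.

(* [g s = f s * exp (- s X)] is a one-parameter group with zero derivative at
   [0], and [g t = g (t / N) ^ N], whence [g = 1]. *)
Lemma one_param_expm n (f : C -> 'M[C]_n) (X : 'M[C]_n) :
  (forall s t, f (s + t) = f s *m f t) -> f 0 = 1%:M ->
  h^-1 *: (f h - 1%:M) @[h --> (0 : C)^'] --> X ->
  forall t, f t = expm (t *: X).
Proof.
move=> fD f0 fX t.
(* Differentiate [f (s + h) = f (h + s)] at [h = 0]. *)
have fXC s : f s *m X = X *m f s.
  have h1 : f s *m (h^-1 *: (f h - 1%:M)) @[h --> (0 : C)^'] --> f s *m X.
    by apply: cvg_mulmx; [exact: cvg_cst|exact: fX].
  have h2 : (h^-1 *: (f h - 1%:M)) *m f s @[h --> (0 : C)^'] --> X *m f s.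
    by apply: cvg_mulmx; [exact: fX|exact: cvg_cst].
  apply: (@cvg_mx_unique _ _ _ _ _ _ _ _ _ h1).
  rewrite [X in X @ _ --> _](_ : _ = fun h => (h^-1 *: (f h - 1%:M)) *m f s)//.
  apply/funext => h; rewrite -scalemxAr -scalemxAl mulmxBr mulmxBl -!fD [s + h]addrC.
  by rewrite mulmx1 mul1mx.
pose e s := expm (s *: - X).
have eD s s' : e (s + s') = e s *m e s'.
  by rewrite /e scalerDl expmD// -!scalemxAl -!scalemxAr scalerA mulrC -scalerA.
have feC s s' : f s *m e s' = e s' *m f s.
  apply/esym/expm_intertwine.
  by rewrite -scalemxAl -scalemxAr mulNmx mulmxN fXC.
pose g s := f s *m e s.
have gD s s' : g (s + s') = g s *m g s'.
  by rewrite /g fD eD -!mulmxA; congr (_ *m _); rewrite !mulmxA feC.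
have gX s k : g (s *+ k) = g s ^+ k.
  elim: k => [|k IH]; last by rewrite mulrS gD IH exprS.
  by rewrite mulr0n expr0 /g f0 /e scale0r expm0 mulmx1.
have e1 : e h @[h --> (0 : C)^'] --> (1%:M : 'M[C]_n).
  exact: cvg_of_quotient (@expm_deriv0 n (- X)).
(* Product rule at [0]: the derivatives [X] of [f] and [- X] of [e] cancel. *)
have g0 : h^-1 *: (g h - 1%:M) @[h --> (0 : C)^'] --> (0 : 'M[C]_n).
  have -> : (0 : 'M[C]_n) = X *m 1%:M + (- X) by rewrite mulmx1 subrr.
  rewrite [X in X @ _ --> _](_ : _ = fun h => (h^-1 *: (f h - 1%:M)) *m e h + h^-1 *: (e h - 1%:M)).
    apply: (@cvgD _ 'M[C]_n); last exact: expm_deriv0.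
    by apply: cvg_mulmx; [exact: fX|exact: e1].
  apply/funext => h; rewrite -scalemxAl -scalerDr; congr (_ *: _).
  by rewrite mulmxBl mul1mx addrA subrK.
have [->|t0] := eqVneq t 0; first by rewrite f0 scale0r expm0.
suff gt : g t = 1%:M.
  have <- : g t *m expm (t *: X) = f t.
    by rewrite /g /e scalerN -mulmxA expmNl mulmx1.
  by rewrite gt mul1mx.
apply/eqP; rewrite -subr_eq0; apply/eqP; apply: mnorm_eq0.
pose h N : C := t / N.+1%:R.
have hn N : h N != 0 by rewrite mulf_neq0// invr_neq0// pnatr_eq0.
(* Convergence to the punctured neighbourhood needs [h N != 0]; hence the separate case [t = 0]. *)
have hcvg : h N @[N --> \oo] --> (0 : C)^'.
  have h0 : h N @[N --> \oo] --> (0 : C).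
    apply/cvg_normc; rewrite -(mulr0 (normc t)).
    rewrite [X in X @ _ --> _](_ : _ = fun N => normc t * harmonic N).
      by apply: cvgM; [exact: cvg_cst|exact: cvg_harmonic].
    by apply/funext => N; rewrite subr0 ComplexField.Normc.normcM normc_natV.
  move=> A hA.
  have h0A : \forall N \near \oo, h N != 0 -> A (h N) by exact: h0 hA.
  by apply: filterS h0A => N; apply; exact: hn.
pose b N := mnorm ((h N)^-1 *: (g (h N) - 1%:M)).
have b0 : b N @[N --> \oo] --> (0 : R).
  have /cvg_mnorm := cvg_comp _ _ hcvg g0.
  by under eq_cvg do rewrite subr0.
(* This is the final bound: with [y = mnorm (g (h N) - 1%:M)], [(1 + y) ^+ N.+1] is at most
   [expR (N.+1%:R * y)], and [N.+1%:R * y] equals [normc t * b N]. *)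
have bb : expR (normc t * b N) - 1 @[N --> \oo] --> (0 : R).
  rewrite [X in _ --> X](_ : _ = expR (normc t * 0) - 1); last by rewrite mulr0 expR0 subrr.
  apply: cvgB; last by apply: cvg_cst.
  apply: (@continuous_cvg _ _ _ _ _ _ (@expR R)); first by apply: continuous_expR.
  by apply: cvgM; [apply: cvg_cst|exact: b0].
apply: (cvgr_to_ge bb); apply: nearW => N.
have tE : t = h N *+ N.+1 by rewrite -mulr_natr divfK// pnatr_eq0.
have -> : g t = (1%:M + (g (h N) - 1%:M)) ^+ N.+1 by rewrite addrC subrK -gX -tE.
apply: le_trans (mnorm_exp1D _ _) _; rewrite lerD2r.
have -> : normc t * b N = N.+1%:R * mnorm (g (h N) - 1%:M).
  rewrite /b mnormZ ComplexField.Normc.normcV ComplexField.Normc.normcM normc_natV.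
  rewrite invfM invrK -!mulrA mulVKf; first by [].
  by rewrite -(inj_eq (@complexI R)) -normr_normc normr_eq0.
rewrite expRM_natl; apply: lerXn2r; rewrite ?nnegrE ?expR_ge0 ?addr_ge0 ?mnorm_ge0//.
exact: expR_ge1Dx.
Qed.

End OneParam.

(** * Derivatives along curves *)

Section NearDiff.
Variables (K : numFieldType) (V W : normedModType K).

(** The first-order expansion of [f] at [x] is also one of [g], and [diff_unique] identifies the
    differential. Identities between chart expressions hold only locally, hence this form. *)
Lemma near_eq_differentiable (f g : V -> W) (x : V) :
  (\forall y \near x, f y = g y) -> differentiable f x -> differentiable g x.
Proof.
move=> fg df; have fgx : f x = g x by exact: nbhs_singleton fg.
have fg0 : \forall y \near (0 : V), f (y + x) = g (y + x).
  have : (y + x) @[y --> (0 : V)] --> x.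
    by rewrite -[X in _ --> X](add0r x); apply: cvgD; [exact: cvg_id|exact: cvg_cst].
  by move=> /(_ _ fg).
have h : g \o shift x = cst (g x) + 'd f x +o_ 0 id.
  apply/eqaddoP => e e0.
  have /eqaddoP /(_ e e0) := diff_locally df.
  apply: filterS2 fg0 => y fgy /=.
  by rewrite /= -fgx; rewrite !fctE /= fgy.
apply/diff_locallyP; have := diff_unique (diff_continuous df) h.
by move=> ->; split => //; exact: diff_continuous.
Qed.

(** The chain rule in terms of difference quotients: the curve needs a derivative at [0] only, and
    [K] is viewed as the normed module [K^o]. *)
Lemma differentiable_curve (G : V -> W) (a M : V) (c : K -> V) :
  c 0 = a -> h^-1 *: (c h - a) @[h --> (0 : K)^'] --> M ->
  differentiable G a ->
  h^-1 *: (G (c h) - G a) @[h --> (0 : K)^'] --> 'd G a M.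
Proof.
move=> c0 cM dG.
have cM' : (fun h => h^-1 *: ((c \o shift (0 : K^o)) (h *: (1 : K^o)) - c 0)) @ (0 : K)^' --> M.
  rewrite (_ : (fun _ => _) = fun h => h^-1 *: (c h - a))//.
  by apply/funext => h /=; rewrite c0 addr0 -[h%:A]/(h * 1) mulr1.
have dc : derivable (c : K^o -> V) 0 1 by apply/cvg_ex; exists M.
have Dc : 'D_1 (c : K^o -> V) 0 = M by apply: cvg_lim.
have dfc : differentiable (c : K^o -> V) 0 by apply/derivable1_diffP.
have dGc : differentiable (G \o (c : K^o -> V)) 0 by apply: differentiable_comp; rewrite ?c0.
have : 'D_1 (G \o (c : K^o -> V)) 0 = 'd G a M.
  rewrite deriveE// diff_comp ?c0//=; congr ('d G a _).
  by rewrite -Dc deriveE.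
move=> <-.
have := @diff_derivable _ _ _ _ _ (1 : K^o) dGc.
rewrite (_ : (fun _ => _) = fun h => h^-1 *:
    (((G \o (c : K^o -> V)) \o shift 0) (h *: (1 : K^o)) - (G \o c) 0))//.
by apply/funext => h /=; rewrite c0 addr0 -[h%:A]/(h * 1) mulr1.
Qed.

End NearDiff.

(** * The differential of a representation *)

Section LieRep.
Variables (R : realType) (d n : nat) (G : complexLieGroup R d) (e : chart R d G).
Hypothesis e1 : chart_at1 e.
Variable rho : G -> 'M[R[i]]_n.
Hypothesis rhoP : representation rho.
Local Notation C := R[i].
Local Notation o := (chart_map e 1%g).

Lemma atlas_is_chart (c : chart R d G) : lg_atlas c -> is_chart c.
Proof. by move=> cA; exact: (atlas_chart (lg_atlasP G)). Qed.

Lemma chart_at1_is_chart : is_chart e.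
Proof. by case: e1 => /atlas_is_chart. Qed.

Lemma chart_inv1 : chart_inv e o = 1%g.
Proof. by apply: (chart_mapK chart_at1_is_chart); case: e1. Qed.

Lemma chart_inv1_cont : chart_inv e u @[u --> o] --> (1%g : G).
Proof.
have := @chart_inv_cont _ _ _ _ chart_at1_is_chart 1%g (e1.2).
by rewrite /prop_for /continuous_at chart_inv1.
Qed.

Lemma cvg_mulg (T : Type) (F : set_system T) {FF : Filter F} (f g : T -> G) (x y : G) :
  f @ F --> x -> g @ F --> y -> (f t * g t)%g @[t --> F] --> (x * y)%g.
Proof.
move=> fx gy; apply: (@cvg_comp _ _ _ (fun t => (f t, g t)) (fun p : G * G => (p.1 * p.2)%g) _
  (nbhs (x, y))); last exact: (@lg_mul_continuous _ _ G (x, y)).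
exact: cvg_pair.
Qed.

Lemma mul_chart_inv_cont (g : G) : (g * chart_inv e u)%g @[u --> o] --> g.
Proof.
rewrite -[X in _ --> X](mulg1 g).
by apply: (@cvg_mulg _ _ (nbhs_filter o)); [exact: cvg_cst|exact: chart_inv1_cont].
Qed.

Lemma conj_chart_inv_cont (g : G) :
  (g * chart_inv e u * g^-1)%g @[u --> o] --> (1%g : G).
Proof.
rewrite -[X in _ --> X](mulgV g).
by apply: (@cvg_mulg _ _ (nbhs_filter o)); [exact: mul_chart_inv_cont|exact: cvg_cst].
Qed.

Lemma near_chart_dom (c : chart R d G) (x : G) (T : Type) (F : set_system T) (f : T -> G) :
  lg_atlas c -> chart_dom c x -> f @ F --> x -> \forall u \near F, chart_dom c (f u).
Proof.
move=> cA cx fx; apply: fx; apply: open_nbhs_nbhs; split => //.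
exact: (chart_open_dom (atlas_is_chart cA)).
Qed.

(** Multiplication is holomorphic in charts only, so conjugation is factored through a chart [c]
    around [g]: left multiplication by [g], then right multiplication by its inverse. The
    factorization is valid where the intermediate product stays in the domain of [c]. *)
Lemma conj_differentiable (g : G) :
  differentiable (fun u : 'rV[C]_d => chart_map e (g * chart_inv e u * g^-1)%g) o.
Proof.
have [eA e1d] := e1.
have [c cA cg] := atlas_cover (lg_atlasP G) g.
have [c' c'A c'g] := atlas_cover (lg_atlasP G) (g^-1)%g.
have cK : chart_inv c (chart_map c g) = g by exact: (chart_mapK (atlas_is_chart cA)).
have c'K : chart_inv c' (chart_map c' g^-1%g) = g^-1%g.
  exact: (chart_mapK (atlas_is_chart c'A)).
have cge : chart_dom c (g * 1)%g by rewrite mulg1.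
have egg : chart_dom e (g * g^-1)%g by rewrite mulgV.
have d1 := lg_mul_holomorphic cA eA cA cg e1d cge.
have d2 := lg_mul_holomorphic cA c'A eA cg c'g egg.
pose F1 (u : 'rV[C]_d) := chart_map c (g * chart_inv e u)%g.
pose F2 (v : 'rV[C]_d) := chart_map e (chart_inv c v * g^-1)%g.
have dF1 : differentiable F1 o.
  rewrite (_ : F1 = (fun p : 'rV[C]_d * 'rV[C]_d =>
     chart_map c (chart_inv c p.1 * chart_inv e p.2)%g) \o
     (fun u => (chart_map c g, u))); last first.
    by apply/funext => u; rewrite /F1 /= cK.
  apply: differentiable_comp; last exact: d1.
  by apply: differentiable_pair; [exact: differentiable_cst|exact: ex_diff].
have dF2 : differentiable F2 (F1 o).
  have -> : F1 o = chart_map c g by rewrite /F1 chart_inv1 mulg1.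
  rewrite (_ : F2 = (fun p : 'rV[C]_d * 'rV[C]_d =>
     chart_map e (chart_inv c p.1 * chart_inv c' p.2)%g) \o
     (fun v => (v, chart_map c' g^-1%g))); last first.
    by apply/funext => u; rewrite /F2 /= c'K.
  apply: differentiable_comp; last exact: d2.
  by apply: differentiable_pair; [exact: ex_diff|exact: differentiable_cst].
apply: near_eq_differentiable (differentiable_comp dF1 dF2).
have := near_chart_dom cA cg (@mul_chart_inv_cont g).
apply: filterS => u cu.
by rewrite /= /F2 /F1 (chart_mapK (atlas_is_chart cA)).
Qed.

Lemma rho_chart_differentiable : differentiable (rho \o chart_inv e) o.
Proof. by case: e1 => eA e1d; exact: (repr_holomorphic rhoP eA e1d). Qed.

Lemma rhoV (g : G) : rho g *m rho g^-1%g = 1%:M.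
Proof. by rewrite -(reprM rhoP) mulgV (repr1 rhoP). Qed.

Lemma rhoVl (g : G) : rho g^-1%g *m rho g = 1%:M.
Proof. by rewrite -(reprM rhoP) mulVg (repr1 rhoP). Qed.

Lemma drepr_cvg (Y : 'rV[C]_d) :
  h^-1 *: (rho (chart_inv e (h *: Y + o)) - 1%:M) @[h --> (0 : C)^'] --> drepr e rho Y.
Proof.
have := @differentiable_curve C _ _ (rho \o chart_inv e) o Y (fun h => h *: Y + o).
rewrite scale0r add0r => /(_ erefl).
have h1 : h^-1 *: (h *: Y + o - o) @[h --> (0 : C)^'] --> Y by exact: cvg_affine.
move=> /(_ h1 rho_chart_differentiable).
by rewrite /= chart_inv1 (repr1 rhoP).
Qed.

(** Differentiate [rho (g x g^-1) = rho g rho x rho g^-1] at [x = 1] along a line of direction [Y]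
    in the chart. The two difference quotients agree for small [h], when the conjugate lies in the
    domain of [e]. *)
Lemma drepr_Ad (g : G) (Y : 'rV[C]_d) :
  drepr e rho (Ad e g Y) = rho g *m drepr e rho Y *m rho g^-1%g.
Proof.
pose k (u : 'rV[C]_d) := chart_map e (g * chart_inv e u * g^-1)%g.
have dk : differentiable k o := conj_differentiable g.
have ko : k o = o by rewrite /k chart_inv1 mulg1 mulgV.
have dr := rho_chart_differentiable.
have drk : differentiable ((rho \o chart_inv e) \o k) o 
  by apply: differentiable_comp; [exact: dk|rewrite ko; exact: dr].
have h1 : h^-1 *: (h *: Y + o - o) @[h --> (0 : C)^'] --> Y by exact: cvg_affine.
have := @differentiable_curve C _ _ ((rho \o chart_inv e) \o k) o Y (fun h => h *: Y + o).
rewrite scale0r add0r => /(_ erefl h1 drk).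
rewrite diff_comp ?ko// => lhs.
have rhs : rho g *m (h^-1 *: (rho (chart_inv e (h *: Y + o)) - 1%:M)) *m rho g^-1%g
    @[h --> (0 : C)^'] --> rho g *m drepr e rho Y *m rho g^-1%g.
  apply: cvg_mulmx; last exact: cvg_cst.
  by apply: cvg_mulmx; [exact: cvg_cst|exact: drepr_cvg].
apply: (@cvg_mx_unique _ _ _ _ _ _ _ _ _ lhs).
apply: cvg_trans rhs; apply: near_eq_cvg.
have lin : h *: Y + o @[h --> (0 : C)^'] --> o by exact: cvg_of_quotient h1.
have dom : \forall h \near (0 : C)^', chart_dom e (g * chart_inv e (h *: Y + o) * g^-1)%g.
  by exact: lin (near_chart_dom e1.1 e1.2 (@conj_chart_inv_cont g)).
apply: filterS dom => h ek /=.
rewrite -scalemxAr -scalemxAl ko chart_inv1 (repr1 rhoP).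
congr (_ *: _).
rewrite /k (chart_mapK chart_at1_is_chart)// !(reprM rhoP).
by rewrite mulmxBr mulmxBl mulmx1 rhoV.
Qed.

(** For a curve [g h] through the unit with direction [X], [drepr_Ad] is used as
    [dr (Ad g Y) rho g = rho g dr Y], with [dr] for [drepr e rho]. Differentiating at [h = 0] gives
    [dr [X, Y] + dr Y dr X = dr X dr Y], without differentiating an inverse. *)
Lemma drepr_bracket (br : 'rV[C]_d -> 'rV[C]_d -> 'rV[C]_d) (X Y : 'rV[C]_d) :
  is_lie_bracket e br ->
  drepr e rho (br X Y) = drepr e rho X *m drepr e rho Y - drepr e rho Y *m drepr e rho X.
Proof.
move=> /(_ X Y) [dA vA].
set Z := drepr e rho Y.
pose g h := chart_inv e (h *: X + o).
have [B BE] : exists B, B = Ad e 1%g Y by exists (Ad e 1%g Y).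
pose q h := h^-1 *: (Ad e (g h) Y - B).
have qcvg : q h @[h --> (0 : C)^'] --> br X Y.
  pose A (u : 'rV[C]_d) := Ad e (chart_inv e u) Y.
  have dA' : h^-1 *: ((A \o shift o) (h *: X) - A o) @[h --> (0 : C)^'] --> br X Y.
    by rewrite -vA; exact: dA.
  rewrite [X in X @ _ --> _](_ : _ = fun h => h^-1 *: ((A \o shift o) (h *: X) - A o)).
    exact: dA'.
  by apply/funext => h; rewrite /q /A /= chart_inv1 BE.
have rg : rho (g h) @[h --> (0 : C)^'] --> (1%:M : 'M[C]_n).
  have := differentiable_continuous rho_chart_differentiable.
  rewrite /prop_for /continuous_at /= chart_inv1 (repr1 rhoP) => rc.
  have lin : h *: X + o @[h --> (0 : C)^'] --> o.
    by apply: (@cvg_of_quotient _ _ _ _ _ X); exact: cvg_affine.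
  exact: (cvg_comp _ _ lin rc).
have Lq : drepr e rho (q h) @[h --> (0 : C)^'] --> drepr e rho (br X Y).
  apply: (@continuous_cvg _ _ _ _ _ _ (drepr e rho)); last exact: qcvg.
  exact: (diff_continuous rho_chart_differentiable).
have lhs : drepr e rho (q h) *m rho (g h) + Z *m (h^-1 *: (rho (g h) - 1%:M))
    @[h --> (0 : C)^'] --> drepr e rho (br X Y) *m 1%:M + Z *m drepr e rho X.
  apply: (@cvgD _ 'M[C]_n).
    by apply: cvg_mulmx; [exact: Lq|exact: rg].
  by apply: cvg_mulmx; [exact: cvg_cst|exact: drepr_cvg].
have rhs : (h^-1 *: (rho (g h) - 1%:M)) *m Z @[h --> (0 : C)^'] --> drepr e rho X *m Z.
  by apply: cvg_mulmx; [exact: drepr_cvg|exact: cvg_cst].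
suff E : drepr e rho (br X Y) *m 1%:M + Z *m drepr e rho X = drepr e rho X *m Z.
  by rewrite -E mulmx1 addrK.
apply: (@cvg_mx_unique _ _ _ _ _ _ _ _ _ lhs).
rewrite [X in X @ _ --> _](_ : _ = fun h => (h^-1 *: (rho (g h) - 1%:M)) *m Z); first exact: rhs.
apply/funext => h.
have -> : drepr e rho (q h) = h^-1 *: (drepr e rho (Ad e (g h) Y) - drepr e rho B).
  by rewrite /q /drepr linearZ linearB.
have -> : drepr e rho B = Z.
  by rewrite BE drepr_Ad invg1 (repr1 rhoP) mul1mx mulmx1.
rewrite drepr_Ad -/Z.
rewrite -!scalemxAl -scalemxAr -scalerDr; congr (_ *: _).
rewrite !mulmxBl mulmxBr -[_ *m rho _ *m _]mulmxA rhoVl mulmx1 mul1mx.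
by rewrite mulmx1 addrA subrK.
Qed.

Lemma sl2_morph1 (phi : 'M[C]_2 -> G) : sl2_morphism phi -> phi 1%:M = 1%g.
Proof.
move=> phiP; have := sl2_morphM phiP (det1 _ _) (det1 _ _).
by rewrite mulmx1 => /(congr1 (fun x => (phi 1%:M)^-1 * x)%g); rewrite mulVg mulKg.
Qed.

(** The extension [F] allows the chain rule on the whole matrix space; along a curve of determinant
    [1] it coincides near the identity with [phi] read in the chart. *)
Lemma sl2_curve (phi : 'M[C]_2 -> G) (M : 'M[C]_2) (x : 'rV[C]_d) (c : C -> 'M[C]_2) :
  sl2_morphism phi -> sl2_differential e phi M x ->
  (forall h, \det (c h) = 1) -> c 0 = 1%:M ->
  h^-1 *: (c h - 1%:M) @[h --> (0 : C)^'] --> M ->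
  h^-1 *: (rho (phi (c h)) - 1%:M) @[h --> (0 : C)^'] --> drepr e rho x.
Proof.
move=> phiP [F Fext <-] c1 c0 cM.
have [dF /(_ (det1 _ _)) [_ F1]] := nbhs_singleton Fext.
have Fo : F 1%:M = o by rewrite F1 sl2_morph1.
have dr := rho_chart_differentiable.
have drF : differentiable ((rho \o chart_inv e) \o F) (1%:M : 'M[C]_2).
  by apply: differentiable_comp; [exact: dF|rewrite Fo; exact: dr].
have := @differentiable_curve C _ _ ((rho \o chart_inv e) \o F) 1%:M M c c0 cM drF.
rewrite diff_comp ?Fo// => h1.
apply: cvg_trans h1; apply: near_eq_cvg.
have cc : c h @[h --> (0 : C)^'] --> (1%:M : 'M[C]_2).
  exact: cvg_of_quotient cM.
have near1 : \forall h \near (0 : C)^',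
    chart_dom e (phi (c h)) /\ F (c h) = chart_map e (phi (c h)).
  have ext : \forall h \near (0 : C)^', differentiable F (c h) /\
    (\det (c h) = 1 -> chart_dom e (phi (c h)) /\ F (c h) = chart_map e (phi (c h))).
    exact: cc Fext.
  by apply: filterS ext => h [_]; apply.
apply: filterS near1 => h [dh Fh] /=.
congr (_ *: (_ - _)); first by rewrite Fh (chart_mapK chart_at1_is_chart dh).
by rewrite Fo chart_inv1 (repr1 rhoP).
Qed.

Lemma sl2_one_param (phi : 'M[C]_2 -> G) (M : 'M[C]_2) (x : 'rV[C]_d) (c : C -> 'M[C]_2) :
  sl2_morphism phi -> sl2_differential e phi M x ->
  (forall h, \det (c h) = 1) -> (forall s t, c (s + t) = c s *m c t) -> c 0 = 1%:M ->
  h^-1 *: (c h - 1%:M) @[h --> (0 : C)^'] --> M ->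
  forall t, rho (phi (c t)) = expm (t *: drepr e rho x).
Proof.
move=> phiP dphi c1 cD c0 cM; apply: one_param_expm.
- by move=> s t; rewrite cD (sl2_morphM phiP)// (reprM rhoP).
- by rewrite c0 sl2_morph1// (repr1 rhoP).
- exact: sl2_curve cM.
Qed.

End LieRep.

(** * Coxeter words and Cartan matrices *)

Section CoxeterWord.
Variables (r : nat) (a : 'M[int]_r).
Hypothesis a2 : forall i, a i i = 2.

Lemma row_simple_reflection i j :
  i != j -> row i (simple_reflection a j) = row i 1%:M.
Proof. by move=> ij; apply/rowP => k; rewrite !mxE (negbTE ij) mul0r subr0. Qed.

Lemma row_weyl_word i (s : seq 'I_r) :
  i \notin s -> row i (weyl_word a s) = row i 1%:M.
Proof.
elim: s => [|j s IH]; first by rewrite /weyl_word big_nil.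
rewrite inE negb_or => /andP[ij /IH is0].
by rewrite /weyl_word big_cons -mulmxE row_mul row_simple_reflection// -row_mul mul1mx.
Qed.

Lemma mulmx_simple_reflection (v : 'rV[int]_r) j l :
  (v *m simple_reflection a j) 0 l = v 0 l - v 0 j * a j l.
Proof.
rewrite mxE.
under eq_bigr => k _ do rewrite mxE mulrBr mulr_natr mulrA mulr_natr.
rewrite sumrB; congr (_ - _).
  by rewrite (bigD1 l)//= eqxx big1 ?addr0// => k /negbTE ->.
rewrite (bigD1 j)//= eqxx big1 ?addr0// => k /negbTE ->.
by rewrite mulr0n mul0r.
Qed.

(** If [v] is killed by [s_j], its entry at [j] satisfies [v_j = 2 v_j], hence vanishes, and then
    [s_j] fixes [v]. *)
Lemma mulmx_weyl_word_inj (s : seq 'I_r) (v : 'rV[int]_r) :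
  v *m weyl_word a s = 0 -> v = 0.
Proof.
elim: s v => [|j s IH] v; first by rewrite /weyl_word big_nil mulmx1.
rewrite /weyl_word big_cons -mulmxE mulmxA => /IH vj.
have vE l : v 0 l - v 0 j * a j l = 0.
  by rewrite -mulmx_simple_reflection vj mxE.
have vj0 : v 0 j = 0 by have := vE j; rewrite a2; lra.
by apply/rowP => l; have := vE l; rewrite vj0 mul0r subr0 mxE.
Qed.

(* The [i]-th row of [weyl_word a t] is trivial if [i] does not occur in [t],
   whereas the reflection [s_i] changes it and the other ones cannot undo that. *)
Lemma coxeter_word_mem (s t : seq 'I_r) i :
  perm_eq s (enum 'I_r) -> weyl_word a t = weyl_word a s -> i \in t.
Proof.
move=> s_enum ts; apply/negPn/negP => /row_weyl_word; rewrite ts => row_i.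
have i_s : i \in s by rewrite (perm_mem s_enum) mem_enum.
have uniq_s : uniq s by rewrite (perm_uniq s_enum) enum_uniq.
case/splitPr: i_s uniq_s row_i => s1 s2.
rewrite cat_uniq /= negb_or => /and3P[_ /andP[is1 _] /andP[is2 _]].
rewrite /weyl_word big_cat big_cons /= -!mulmxE row_mul (row_weyl_word is1).
rewrite -row_mul mul1mx row_mul -/(weyl_word a s2) => row_i.
have : (row i (simple_reflection a i) - row i 1%:M) *m weyl_word a s2 = 0.
  by rewrite mulmxBl row_i -[X in _ - X]row_mul mul1mx row_weyl_word// subrr.
move=> /mulmx_weyl_word_inj /rowP /(_ i); by rewrite !mxE !eqxx a2.
Qed.

(** All [r] indices occur in a word of length [r], which leaves no room for a repetition. *)
Lemma coxeter_word_uniq (s : seq 'I_r) (t : r.-tuple 'I_r) :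
  perm_eq s (enum 'I_r) -> weyl_word a t = weyl_word a s -> uniq t.
Proof.
move=> s_enum ts; apply: (@leq_size_uniq _ (enum 'I_r)) (enum_uniq _) _ _.
  by move=> i _; exact: coxeter_word_mem ts.
by rewrite size_tuple -cardE card_ord.
Qed.

End CoxeterWord.

(** A kernel vector would be isotropic for the positive definite symmetrized form. The transpose
    appears because [det0P] provides a left kernel vector. *)
Lemma cartan_matrix_det (r : nat) (a : 'M[int]_r) : cartan_matrix a -> \det a != 0.
Proof.
case=> _ _ _ [D _ [_ Dpos]]; rewrite -det_tr; apply/negP => /det0P[v v0 va].
have /Dpos : exists i, v 0 i != 0.
  by apply/existsP; apply: contraNT v0 => /existsPn vi; apply/eqP/rowP => i;
     rewrite mxE; apply/eqP/negPn/vi.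
rewrite big1 ?ltxx// => i _.
transitivity (v 0 i * D i * (v *m a^T) 0 i); last by rewrite va mxE mulr0.
rewrite mxE mulr_sumr; apply: eq_bigr => j _.
by rewrite mxE; ring.
Qed.

(** * Reordering products of root and torus elements *)

Section BigComm.
Variables (K : fieldType) (A : pzRingType) (I : eqType) (E F : I -> K -> A).

Hypothesis EF : forall i j x y, i != j -> E i x * F j y = F j y * E i x.

Lemma commE_prodF i (s : seq I) x y : i \notin s ->
  E i x * \prod_(j <- s) F j (y j) = (\prod_(j <- s) F j (y j)) * E i x.
Proof.
move=> is_; rewrite big_seq; apply: commr_prod => j js; apply: EF.
by apply: contraNneq is_ => ->.
Qed.

Lemma commF_prodE i (s : seq I) x y : i \notin s ->
  F i y * \prod_(j <- s) E j (x j) = (\prod_(j <- s) E j (x j)) * F i y.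
Proof.
move=> is_; rewrite big_seq; apply: commr_prod => j js; apply/esym/EF.
by apply: contraNneq is_ => <-.
Qed.

(** Each [F i] moves right past the later [E j], whose indices differ from [i] because [s] has no
    repetition. *)
Lemma prod_EF (s : seq I) (x y : I -> K) : uniq s ->
  \prod_(i <- s) (E i (x i) * F i (y i)) =
  (\prod_(i <- s) E i (x i)) * \prod_(i <- s) F i (y i).
Proof.
elim: s => [|i s IH]; first by rewrite !big_nil mulr1.
rewrite /= => /andP[is_ us]; rewrite !big_cons IH// -!mulrA; congr (_ * _).
by rewrite mulrA commF_prodE// -mulrA.
Qed.

Variables (D : I -> A) (q : I -> I -> K).
Hypothesis q0 : forall k i, q k i != 0.
Hypothesis ED : forall i k x, E i x * D k = D k * E i (x * q k i).
Hypothesis FD : forall i k x, F i x * D k = D k * F i (x / q k i).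

Lemma E_prodD i (s : seq I) x :
  E i x * \prod_(k <- s) D k = (\prod_(k <- s) D k) * E i (x * \prod_(k <- s) q k i).
Proof.
elim: s x => [|k s IH] x; first by rewrite !big_nil !mulr1 mul1r.
by rewrite !big_cons mulrA ED -mulrA IH !mulrA.
Qed.

Lemma F_prodD i (s : seq I) x :
  F i x * \prod_(k <- s) D k = (\prod_(k <- s) D k) * F i (x / \prod_(k <- s) q k i).
Proof.
elim: s x => [|k s IH] x; first by rewrite !big_nil divr1 mulr1 mul1r.
by rewrite !big_cons mulrA FD -mulrA IH !mulrA invfM mulrA.
Qed.

(** Moving a torus factor of another index across both [F i] and [E i] rescales their parameters
    inversely and preserves the product. Only [D i], which stands between them, is crossed by [F i]
    alone; this leaves the factor [q i i]. *)
Lemma prod_FDE (s : seq I) (x y : I -> K) : uniq s ->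
  exists c d : I -> K,
    (forall i, i \in s -> c i * d i = y i * x i / q i i) /\
    \prod_(i <- s) (F i (y i) * D i * E i (x i)) =
    (\prod_(i <- s) D i) * ((\prod_(i <- s) F i (c i)) * \prod_(i <- s) E i (d i)).
Proof.
elim: s => [|i s IH]; first by exists x, y; split => //; rewrite !big_nil !mulr1.
rewrite /= => /andP[is_ /IH[c [d [cd prodE]]]].
pose u := \prod_(k <- s) q k i.
have u0 : u != 0 by rewrite prodf_seq_neq0; apply/allP => k _; rewrite q0.
(* [F i] crosses [D i] and all later torus factors, [E i] only the later ones, whose total effect is
   [u]. *)
pose c' j := if j == i then y i / q i i / u else c j.
pose d' j := if j == i then x i * u else d j.
have nis j : j \in s -> (j == i) = false by apply: contraTF => /eqP ->.
exists c', d'; split.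
  move=> j; rewrite inE /c' /d'; case: eqP => [-> _|_ /=]; last exact: cd.
  by field; rewrite u0 q0.
rewrite !big_cons prodE.
have -> : \prod_(j <- s) F j (c' j) = \prod_(j <- s) F j (c j).
  by apply: eq_big_seq => j /nis js; rewrite /c' js.
have -> : \prod_(j <- s) E j (d' j) = \prod_(j <- s) E j (d j).
  by apply: eq_big_seq => j /nis js; rewrite /d' js.
rewrite /c' /d' eqxx !mulrA FD -(mulrA _ (E i (x i))) E_prodD !mulrA.
rewrite -(mulrA _ (F i (y i / q i i))) F_prodD !mulrA -/u.
by rewrite -(mulrA _ (E i (x i * u))) commE_prodF// !mulrA.
Qed.

End BigComm.

(** * The trace identity *)

Section Weights.
Variable R : realType.
Local Notation C := R[i].

Definition lie_mx n (A B : 'M[C]_n) : 'M[C]_n := A *m B - B *m A.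

Lemma lie_mx_suml n (I : finType) (l : I -> C) (A : I -> 'M[C]_n) (B : 'M[C]_n) :
  lie_mx (\sum_i l i *: A i) B = \sum_i l i *: lie_mx (A i) B.
Proof.
rewrite /lie_mx mulmx_suml mulmx_sumr -sumrB; apply: eq_bigr => i _.
by rewrite -scalemxAl -scalemxAr scalerBr.
Qed.

Lemma lie_mx_eq0 n (A B : 'M[C]_n) : lie_mx A B = 0 <-> A *m B = B *m A.
Proof. by split=> [/subr0_eq//|]; rewrite /lie_mx => ->; rewrite subrr. Qed.

Lemma lie_mxC n (A B : 'M[C]_n) : lie_mx A B = - lie_mx B A.
Proof. by rewrite /lie_mx opprB. Qed.

(** The hypothesis reads [A X = X (A + w)], so [exp A] carries [X] to [expC w] times [X] under
    conjugation, and therefore also the exponentials of its multiples. *)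
Lemma expm_weight n (A X : 'M[C]_n) (w x : C) : lie_mx A X = w *: X ->
  expm A *m expm (x *: X) = expm ((x * expC w) *: X) *m expm A.
Proof.
move=> AX.
have AX' : A *m X = X *m (A + w%:M).
  by rewrite mulmxDr mul_mx_scalar -AX addrC subrK.
have eAX : expm A *m X = expC w *: (X *m expm A).
  by rewrite (expm_intertwine AX') expmD ?scalar_mxC// expm_scalar mulmxA mul_mx_scalar.
apply/esym/expm_intertwine.
by rewrite -scalemxAr eAX scalerA -scalemxAl.
Qed.

Lemma expm_prod n (I : Type) (s : seq I) (A : I -> 'M[C]_n) :
  (forall i j, A i *m A j = A j *m A i) ->
  \prod_(i <- s) expm (A i) = expm (\sum_(i <- s) A i).
Proof.
move=> AA; elim: s => [|i s IH]; first by rewrite !big_nil expm0.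
rewrite !big_cons IH expmD//.
by rewrite mulmx_suml mulmx_sumr; apply: eq_bigr => j _.
Qed.

Lemma intertwine_prod n (I : Type) (s : seq I) (A B : I -> 'M[C]_n) (S : 'M[C]_n) :
  (forall i, S *m A i = B i *m S) ->
  S *m \prod_(i <- s) A i = (\prod_(i <- s) B i) *m S.
Proof.
move=> SAB; elim: s => [|i s IH]; first by rewrite !big_nil mulmx1 mul1mx.
by rewrite !big_cons -!mulmxE mulmxA SAB -mulmxA IH mulmxA.
Qed.

Section Trace.
Variables (r n : nat) (a : 'M[int]_r).
Hypothesis a2 : forall i, a i i = 2.
Variables (E F : 'I_r -> C -> 'M[C]_n) (T : ('I_r -> C) -> 'M[C]_n).
Hypothesis torus_E : forall l i x, T l *m E i x = E i (x * expC (l i)) *m T l.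
Hypothesis torus_F : forall l i x, T l *m F i x = F i (x * expC (- l i)) *m T l.
Hypothesis torus_comm : forall l l', T l *m T l' = T l' *m T l.
Hypothesis torusN : forall l, T l *m T (fun i => - l i) = 1%:M.
Hypothesis EF : forall i j x y, i != j -> E i x * F j y = F j y * E i x.

(* The trace below depends on the parameters [c i] and [d i] only through the
   products [c i * d i]: rescaling them is conjugation by a torus element. *)
Lemma trace_rescale (l c d c' d' : 'I_r -> C) (s : seq 'I_r) :
  (forall i, c i * d i = c' i * d' i) ->
  (forall i, d i != 0) -> (forall i, d' i != 0) ->
  \tr (T l *m (\prod_(i <- s) F i (c i) *m \prod_(i <- s) E i (d i))) =
  \tr (T l *m (\prod_(i <- s) F i (c' i) *m \prod_(i <- s) E i (d' i))).
Proof.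
move=> cd d0 d'0.
(* Conjugation by [T nu] multiplies [d i] by [d' i / d i] and divides [c i] by it, which yields
   [c' i]. *)
have /choice[nu nuE] : forall i, exists w : C, expC w = d' i / d i.
  by move=> i; apply: expC_surj; rewrite mulf_neq0 ?invr_neq0.
have SF : T nu *m \prod_(i <- s) F i (c i) = \prod_(i <- s) F i (c' i) *m T nu.
  have cE i : c i * expC (- nu i) = c' i.
    by rewrite expCN nuE invf_div mulrA cd mulfK.
  apply: (@intertwine_prod _ _ s (fun i => F i (c i)) (fun i => F i (c' i))) => i.
  by rewrite /= torus_F cE.
have SE : T nu *m \prod_(i <- s) E i (d i) = \prod_(i <- s) E i (d' i) *m T nu.
  have dE i : d i * expC (nu i) = d' i by rewrite nuE mulrC divfK.
  apply: (@intertwine_prod _ _ s (fun i => E i (d i)) (fun i => E i (d' i))) => i.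
  by rewrite /= torus_E dE.
set P := (X in \tr (T l *m X) = _); set P' := (X in _ = \tr (T l *m X)).
have SP : T nu *m P = P' *m T nu by rewrite /P /P' mulmxA SF -mulmxA SE mulmxA.
move: P P' SP => P P' SP; have -> : P = T (fun i => - nu i) *m (P' *m T nu).
  by rewrite -SP mulmxA torus_comm torusN mul1mx.
(* By cyclicity [T nu] comes to the front, commutes with [T l] and cancels its inverse. *)
rewrite !mulmxA mxtrace_mulC !mulmxA [T nu *m T l]torus_comm -(mulmxA (T l) (T nu)).
by rewrite torusN mulmx1.
Qed.

(** An abstract form of the theorem, in which root subgroups and torus enter only through their
    commutation relations. *)
Lemma trace_invariance (word : r.-tuple 'I_r) (m m' mu l l' : 'I_r -> C) (D : 'I_r -> 'M[C]_n) :
  uniq word -> (forall i, m i != 0) -> (forall i, m' i != 0) ->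
  (forall i, expC (mu i) = 1 - m i) -> (forall i, expC (l' i) = m i / m' i) ->
  (forall k, D k = T (fun i => mu k * (a k i)%:~R)) ->
  T l' = T l *m \prod_(k <- word) D k ->
  \tr (T l' *m \prod_(i <- word) (E i (m' i) *m F i (-1))) =
  \tr (T l *m \prod_(i <- word)
     (F i (- (1 - m i)^-1) *m D i *m E i (m i / (1 - m i)))).
Proof.
move=> uw m0 m'0 muE l'E DE Tl'.
have mem_word i : i \in (word : seq _).
  have sub : {subset (word : seq _) <= enum 'I_r} by move=> j _; rewrite mem_enum.
  have sz : (size (enum 'I_r) <= size word)%N by rewrite size_tuple size_enum_ord.
  by have [_ ->] := uniq_min_size uw sub sz; rewrite mem_enum.
have t0 i : 1 - m i != 0 by rewrite -muE expC_neq0.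
(* The root [i] takes the value [expC (mu k * a k i)] on [D k]; moving [D k] to the left conjugates
   by its inverse, hence the sign. *)
pose q k i := expC (- (mu k * (a k i)%:~R)).
have ED i k x : E i x * D k = D k * E i (x * q k i).
  rewrite DE; apply/esym; rewrite -!mulmxE torus_E.
  by rewrite -mulrA /q -expCD addNr expC0 mulr1.
have FD i k x : F i x * D k = D k * F i (x / q k i).
  rewrite DE; apply/esym; rewrite -!mulmxE torus_F.
  by rewrite -mulrA /q -expCN -expCD opprK subrr expC0 mulr1.
have q0 k i : q k i != 0 by exact: expC_neq0.
have qii i : q i i = (1 - m i) ^- 2.
  by rewrite /q a2 expCN mulrC -[_%:~R]/(1 + 1) mulrDl mul1r expCD muE.
have -> : \prod_(i <- word) (E i (m' i) *m F i (-1)) =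
    (\prod_(i <- word) E i (m' i)) * \prod_(i <- word) F i (-1).
  exact: (prod_EF EF).
have TE : T l' *m \prod_(i <- word) E i (m' i) = \prod_(i <- word) E i (m i) *m T l'.
  have mE i : m' i * expC (l' i) = m i by rewrite l'E mulrC divfK.
  apply: (@intertwine_prod _ _ word (fun i => E i (m' i)) (fun i => E i (m i))) => i.
  by rewrite /= torus_E mE.
(* Cyclicity brings the product of the [E i (m i)] behind the product of the [F i (-1)]. *)
rewrite -mulmxE mulmxA TE -mulmxA mxtrace_mulC -mulmxA.
have [c [d [cd ->]]] := prod_FDE EF q0 ED FD
  (fun i => m i / (1 - m i)) (fun i => - (1 - m i)^-1) uw.
rewrite -!mulmxE [T l *m _]mulmxA -Tl'.
(* The product [- (1 - m i)^-1 * (m i / (1 - m i))] is divided by [q i i = (1 - m i) ^- 2]. *)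
have {}cd i : c i * d i = - m i.
  rewrite cd// qii; field; exact: t0.
apply/esym/trace_rescale => // i; first by rewrite cd mulN1r.
by move: (m0 i); rewrite -oppr_eq0 -cd mulf_eq0 negb_or => /andP[].
Qed.

End Trace.
End Weights.

(** * Torus elements acting in a representation *)

Section Torus.
Variable R : realType.
Local Notation C := R[i].
Variables (r n : nat) (a : 'M[int]_r).
Variables (X Y H hd : 'I_r -> 'M[C]_n).
Hypothesis hdX : forall i j, lie_mx (hd i) (X j) = (i == j)%:R *: X j.
Hypothesis hdY : forall i j, lie_mx (hd i) (Y j) = (- (i == j)%:R) *: Y j.
Hypothesis hdhd : forall i j, hd i *m hd j = hd j *m hd i.
Hypothesis XY : forall i j, i != j -> X i *m Y j = Y j *m X i.
Hypothesis Hhd : forall j, H j = \sum_i (a j i)%:~R *: hd i.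

Let E i (x : C) := expm (x *: X i).
Let F i (x : C) := expm (x *: Y i).
Let T (l : 'I_r -> C) := expm (\sum_i l i *: hd i).

Lemma torus_E l i x : T l *m E i x = E i (x * expC (l i)) *m T l.
Proof.
apply: expm_weight; rewrite lie_mx_suml (bigD1 i)//= big1 => [|j ji].
  by rewrite hdX eqxx scale1r addr0.
by rewrite hdX (negbTE ji) scale0r scaler0.
Qed.

Lemma torus_F l i x : T l *m F i x = F i (x * expC (- l i)) *m T l.
Proof.
apply: expm_weight; rewrite lie_mx_suml (bigD1 i)//= big1 => [|j ji].
  by rewrite hdY eqxx scalerA mulrN1 addr0.
by rewrite hdY (negbTE ji) oppr0 scale0r scaler0.
Qed.

Lemma torusD l l' : T (fun i => l i + l' i) = T l *m T l'.
Proof.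
rewrite /T -expmD; last first.
  rewrite mulmx_suml mulmx_sumr; apply: eq_bigr => i _.
  rewrite mulmx_suml mulmx_sumr; apply: eq_bigr => j _.
  by rewrite -!scalemxAl -!scalemxAr hdhd !scalerA mulrC.
by rewrite -big_split; congr expm; apply: eq_bigr => i _; rewrite scalerDl.
Qed.

Lemma torus_comm l l' : T l *m T l' = T l' *m T l.
Proof.
transitivity (T (fun i => l i + l' i)); first by rewrite torusD.
transitivity (T (fun i => l' i + l i)); last by rewrite torusD.
by congr (T _); apply/funext => i; rewrite addrC.
Qed.

Lemma torusN l : T l *m T (fun i => - l i) = 1%:M.
Proof.
by rewrite -torusD /T big1 ?expm0// => i _; rewrite subrr scale0r.
Qed.

Lemma expm_coroot m k : expm (m *: H k) = T (fun i => m * (a k i)%:~R).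
Proof.
by rewrite Hhd scaler_sumr; congr expm; apply: eq_bigr => i _; rewrite scalerA.
Qed.

Lemma torus_prod l : \prod_i expm (l i *: hd i) = T l.
Proof.
by apply: expm_prod => i j; rewrite -!scalemxAl -!scalemxAr hdhd !scalerA mulrC.
Qed.

(** Passes from the order of the Coxeter word to the standard order of the indices; the [H i]
    commute, being combinations of the commuting [hd]. *)
Lemma coroot_prod_perm (mu : 'I_r -> C) (s : seq 'I_r) : perm_eq s (enum 'I_r) ->
  \prod_(i <- s) expm (mu i *: H i) = \prod_i expm (mu i *: H i).
Proof.
move=> se; have HH i j : H i *m H j = H j *m H i.
  rewrite !Hhd mulmx_suml mulmx_sumr; apply: eq_bigr => k _.
  rewrite mulmx_suml mulmx_sumr; apply: eq_bigr => l _.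
  by rewrite -!scalemxAl -!scalemxAr hdhd !scalerA mulrC.
have mH i j : (mu i *: H i) *m (mu j *: H j) = (mu j *: H j) *m (mu i *: H i).
  by rewrite -!scalemxAl -!scalemxAr HH !scalerA mulrC.
rewrite (expm_prod _ mH) [RHS](expm_prod _ mH); congr (expm _).
by rewrite (perm_big _ se)/= big_enum.
Qed.

End Torus.

(** * Factorizations in [SL_2] and their images under [rho] *)

Section SL2.
Variable R : realType.
Local Notation C := R[i].

Lemma mx2P (A B : 'M[C]_2) :
  A 0 0 = B 0 0 -> A 0 1 = B 0 1 -> A 1 0 = B 1 0 -> A 1 1 = B 1 1 -> A = B.
Proof.
move=> h00 h01 h10 h11; apply/matrixP => i j.
have [->|->] : i = 0 \/ i = 1.
  by case: i => [[|[|//]] p]; [left|right]; apply/val_inj.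
  by have [->|->] : j = 0 \/ j = 1
    by case: j => [[|[|//]] p]; [left|right]; apply/val_inj.
by have [->|->] : j = 0 \/ j = 1
  by case: j => [[|[|//]] p]; [left|right]; apply/val_inj.
Qed.

Lemma mulmx2 (p q s t p' q' s' t' : C) :
  mx2 p q s t *m mx2 p' q' s' t' =
  mx2 (p * p' + q * s') (p * q' + q * t') (s * p' + t * s') (s * q' + t * t').
Proof.
by apply: mx2P; rewrite !mxE !big_ord_recl big_ord0 !mxE /= addr0.
Qed.

Lemma det_of_mx2 (p q s t : C) : \det (mx2 p q s t) = p * t - q * s.
Proof. rewrite (expand_det_row _ 0) !big_ord_recl big_ord0 /cofactor !det_mx11 !mxE /=.
by rewrite addr0 /bump /= expr0 expr1; ring. Qed.

Lemma scalar_mx2 (p : C) : p%:M = mx2 p 0 0 p.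
Proof. by apply: mx2P; rewrite !mxE. Qed.

Lemma gmx_EF (z : C) : gmx z = mx2 1 z 0 1 *m mx2 1 0 (-1) 1.
Proof. by rewrite mulmx2 /gmx; congr mx2; ring. Qed.

(** The lower-diagonal-upper Gauss decomposition, whose pivot is the upper left entry [1 - z]. *)
Lemma gmx_FDE (z : C) : 1 - z != 0 ->
  gmx z = mx2 1 0 (- (1 - z)^-1) 1 *m mx2 (1 - z) 0 0 (1 - z)^-1
          *m mx2 1 (z / (1 - z)) 0 1.
Proof. by move=> z1; rewrite !mulmx2 /gmx; congr mx2; field. Qed.

(** The basis columns are eigenvectors for [z] and [- z]. In this form the diagonal subgroup gets
    its group law and derivative from [expmD] and [expm_deriv0]. *)
Lemma expm_mx2_diag (z : C) :
  expm (z *: mx2 1 0 0 (-1)) = mx2 (expC z) 0 0 (expC z)^-1.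
Proof.
have col_eigen (A : 'M[C]_2) (w : C) (v : 'cV[C]_2) :
    A *m v = w *: v -> expm A *m v = expC w *: v.
  move=> Av; rewrite (@expm_intertwine _ _ _ A (w%:M : 'M[C]_1) v).
    by rewrite expm_scalar mul_mx_scalar.
  by rewrite mul_mx_scalar.
have c0 := @col_eigen (z *: mx2 1 0 0 (-1)) z (delta_mx 0 0).
have c1 := @col_eigen (z *: mx2 1 0 0 (-1)) (- z) (delta_mx 1 0).
have e0 : (z *: mx2 1 0 0 (-1)) *m delta_mx 0 0 = z *: (delta_mx 0 0 : 'cV[C]_2).
  rewrite -scalemxAl; congr (_ *: _); apply/colP => i; rewrite -colE !mxE.
  by case: i => [[|[|//]] p].
have e1 : (z *: mx2 1 0 0 (-1)) *m delta_mx 1 0 = - z *: (delta_mx 1 0 : 'cV[C]_2).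
  rewrite scaleNr -scalerN -scalemxAl; congr (_ *: _); apply/colP => i; rewrite -colE !mxE.
  by case: i => [[|[|//]] p]; rewrite /= ?oppr0.
move: (c0 e0) (c1 e1); rewrite -!colE => /colP k0 /colP k1.
apply: mx2P.
- by have := k0 0; rewrite !mxE /= mulr1.
- by have := k1 0; rewrite !mxE /= mulr0.
- by have := k0 1; rewrite !mxE /= mulr0.
- by have := k1 1; rewrite !mxE /= mulr1 expCN.
Qed.

Section OneParamSL2.
Variables (d n : nat) (G : complexLieGroup R d) (e : chart R d G).
Hypothesis e1 : chart_at1 e.
Variable rho : G -> 'M[C]_n.
Hypothesis rhoP : representation rho.
Variables (phi : 'M[C]_2 -> G) (xp h xm : 'rV[C]_d).
Hypothesis phiP : sl2_triple_morphism e phi xp h xm.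

Lemma rho_phi_upper (t : C) : rho (phi (mx2 1 t 0 1)) = expm (t *: drepr e rho xp).
Proof.
case: phiP => phiM dp _ _.
apply: (sl2_one_param e1 rhoP (c := fun t => mx2 1 t 0 1) phiM dp).
- by move=> s; rewrite det_of_mx2 mulr1 mulr0 subr0.
- by move=> s s'; rewrite mulmx2; congr mx2; ring.
- by rewrite scalar_mx2.
- by apply: cvg_affine => s; apply: mx2P; rewrite !mxE /=; ring.
Qed.

Lemma rho_phi_lower (t : C) : rho (phi (mx2 1 0 t 1)) = expm (t *: drepr e rho xm).
Proof.
case: phiP => phiM _ _ dm.
apply: (sl2_one_param e1 rhoP (c := fun t => mx2 1 0 t 1) phiM dm).
- by move=> s; rewrite det_of_mx2 mulr1 mul0r subr0.
- by move=> s s'; rewrite mulmx2; congr mx2; ring.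
- by rewrite scalar_mx2.
- by apply: cvg_affine => s; apply: mx2P; rewrite !mxE /=; ring.
Qed.

Lemma rho_phi_diag (t : C) :
  rho (phi (mx2 (expC t) 0 0 (expC t)^-1)) = expm (t *: drepr e rho h).
Proof.
case: phiP => phiM _ dh _; rewrite -expm_mx2_diag.
apply: (sl2_one_param e1 rhoP (c := fun t => expm (t *: mx2 1 0 0 (-1))) phiM dh).
- by move=> s; rewrite expm_mx2_diag det_of_mx2 mulr0 subr0 mulfV// expC_neq0.
- move=> s s'; rewrite scalerDl expmD//.
  by rewrite -!scalemxAl -!scalemxAr !scalerA mulrC.
- by rewrite scale0r expm0.
- exact: expm_deriv0.
Qed.

Lemma rho_phiM (A B : 'M[C]_2) : \det A = 1 -> \det B = 1 ->
  rho (phi (A *m B)) = rho (phi A) *m rho (phi B).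
Proof.
by case: phiP => phiM _ _ _ dA dB; rewrite (sl2_morphM phiM)// (reprM rhoP).
Qed.

Lemma rho_gmx_EF (z : C) : rho (phi (gmx z)) =
  expm (z *: drepr e rho xp) *m expm (-1 *: drepr e rho xm).
Proof.
rewrite gmx_EF rho_phiM ?det_of_mx2; first by rewrite rho_phi_upper rho_phi_lower.
  by ring.
by ring.
Qed.

(** Any logarithm [w] of [1 - z] serves, since the group element involves [expC w] only. *)
Lemma rho_gmx_FDE (z w : C) : expC w = 1 - z -> rho (phi (gmx z)) =
  expm (- (1 - z)^-1 *: drepr e rho xm) *m expm (w *: drepr e rho h) *m
  expm (z / (1 - z) *: drepr e rho xp).
Proof.
move=> wE; have z1 : 1 - z != 0 by rewrite -wE expC_neq0.
rewrite gmx_FDE// rho_phiM ?det_mulmx ?det_of_mx2.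
- rewrite rho_phiM ?det_of_mx2.
  + by rewrite rho_phi_upper rho_phi_lower -wE rho_phi_diag.
  + by ring.
  + by rewrite mulr0 subr0 mulfV.
- by field.
- by ring.
Qed.

End OneParamSL2.
End SL2.

(** * Proof of the theorem *)

Lemma rho_prod (R : realType) (d n : nat) (G : complexLieGroup R d)
    (rho : G -> 'M[R[i]]_n) (rhoP : representation rho) (I : Type) (s : seq I)
    (g : I -> G) :
  rho (\prod_(i <- s) g i)%g = \prod_(i <- s) rho (g i).
Proof.
elim: s => [|i s IH]; first by rewrite !big_nil (repr1 rhoP).
by rewrite !big_cons (reprM rhoP) IH.
Qed.

(** * Chevalley relations for the differential of the representation *)

Section ChevalleyRep.
Variables (R : realType) (d r n : nat) (G : complexLieGroup R d) (e : chart R d G).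
Hypothesis e1 : chart_at1 e.
Variable br : 'rV[R[i]]_d -> 'rV[R[i]]_d -> 'rV[R[i]]_d.
Hypothesis brP : is_lie_bracket e br.
Variable a : 'M[int]_r.
Hypothesis aP : cartan_matrix a.
Variables xp xm h hd : 'I_r -> 'rV[R[i]]_d.
Hypothesis chevP : chevalley_generators br a xp xm h.
Hypothesis hdP : is_hdual a h hd.
Variable rho : G -> 'M[R[i]]_n.
Hypothesis rhoP : representation rho.
Local Notation C := R[i].
Local Notation dr := (drepr e rho).

Lemma lie_mx_drepr x y : lie_mx (dr x) (dr y) = dr (br x y).
Proof. by rewrite (drepr_bracket e1 rhoP _ _ brP). Qed.

Lemma drepr_hxp i j : lie_mx (dr (h i)) (dr (xp j)) = (a i j)%:~R *: dr (xp j).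
Proof. by rewrite lie_mx_drepr (chev_hxp chevP) /drepr linearZ. Qed.

Lemma drepr_hxm i j : lie_mx (dr (h i)) (dr (xm j)) = - (a i j)%:~R *: dr (xm j).
Proof. by rewrite lie_mx_drepr (chev_hxm chevP) /drepr linearN linearZ scaleNr. Qed.

Lemma drepr_xpxm i j : i != j -> dr (xp i) *m dr (xm j) = dr (xm j) *m dr (xp i).
Proof.
move=> /negbTE ij; apply/lie_mx_eq0.
by rewrite lie_mx_drepr (chev_xpxm chevP) ij /drepr linear0.
Qed.

Lemma drepr_hh i j : dr (h i) *m dr (h j) = dr (h j) *m dr (h i).
Proof.
apply/lie_mx_eq0; rewrite lie_mx_drepr.
have /(chev_cartan chevP) -> : h j \in cartan_span h.
  by apply: memv_span; exact: codom_f.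
by rewrite /drepr linear0.
Qed.

Lemma drepr_h j : dr (h j) = \sum_i (a j i)%:~R *: dr (hd i).
Proof.
by rewrite hdP.2 /drepr linear_sum; apply: eq_bigr => i _; rewrite linearZ.
Qed.

Let B : 'M[C]_r := invmx (map_mx intr a).

Lemma mul_inv_cartan : B *m map_mx intr a = 1%:M.
Proof.
rewrite mulVmx// unitmxE det_map_mx unitfE intr_eq0.
exact: cartan_matrix_det.
Qed.

(** The [h^i] are defined implicitly by [h_j]; inverting the Cartan matrix expresses them through
    the [h_j], from whose brackets those of the [h^i] follow. *)
Lemma drepr_hd i : dr (hd i) = \sum_j B i j *: dr (h j).
Proof.
transitivity (\sum_k (B *m map_mx intr a) i k *: dr (hd k)).
  rewrite mul_inv_cartan (bigD1 i)//= big1 => [|k /negbTE ki].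
    by rewrite mxE eqxx scale1r addr0.
  by rewrite mxE eq_sym ki scale0r.
under [RHS]eq_bigr do rewrite drepr_h scaler_sumr.
rewrite exchange_big; apply: eq_bigr => k _.
by rewrite mxE scaler_suml; apply: eq_bigr => j _; rewrite mxE scalerA.
Qed.

Lemma drepr_hdxp i k : lie_mx (dr (hd i)) (dr (xp k)) = (i == k)%:R *: dr (xp k).
Proof.
have -> : (i == k)%:R = (B *m map_mx intr a) i k by rewrite mul_inv_cartan mxE.
rewrite drepr_hd lie_mx_suml mxE scaler_suml; apply: eq_bigr => j _.
by rewrite drepr_hxp scalerA mxE.
Qed.

Lemma drepr_hdxm i k : lie_mx (dr (hd i)) (dr (xm k)) = - (i == k)%:R *: dr (xm k).
Proof.
have -> : (i == k)%:R = (B *m map_mx intr a) i k by rewrite mul_inv_cartan mxE.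
rewrite drepr_hd lie_mx_suml mxE scaleNr scaler_suml -sumrN; apply: eq_bigr => j _.
by rewrite drepr_hxm scalerA mxE mulrN scaleNr.
Qed.

Lemma drepr_hdhd i j : dr (hd i) *m dr (hd j) = dr (hd j) *m dr (hd i).
Proof.
apply/lie_mx_eq0; rewrite drepr_hd lie_mx_suml big1// => k _.
rewrite lie_mxC drepr_hd lie_mx_suml big1 ?oppr0 ?scaler0// => l _.
by have /lie_mx_eq0 -> := drepr_hh l k; rewrite scaler0.
Qed.

End ChevalleyRep.

Theorem theorem4 (R : realType) (d r n : nat)
  (G : complexLieGroup R d)
  (Gconn : connected [set: G]) (Gsconn : simply_connected R G)
  (e : chart R d G) (e1 : chart_at1 e)
  (br : 'rV[R[i]]_d -> 'rV[R[i]]_d -> 'rV[R[i]]_d)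
  (brP : is_lie_bracket e br) (Gsimple : simple_lie_algebra br)
  (a : 'M[int]_r) (aP : cartan_matrix a)
  (xp xm h : 'I_r -> 'rV[R[i]]_d)
  (chevP : chevalley_generators br a xp xm h)
  (hd : 'I_r -> 'rV[R[i]]_d) (hdP : is_hdual a h hd)
  (phi : 'I_r -> 'M[R[i]]_2 -> G)
  (phiP : forall j, sl2_triple_morphism e (phi j) (xp j) (h j) (xm j))
  (word : r.-tuple 'I_r)
  (word_reduced : reduced_word a word)
  (word_coxeter : coxeter_element a (weyl_word a word))
  (rho : G -> 'M[R[i]]_n) (rhoP : representation rho)
  (chip chim : 'I_r -> R[i])
  (chip_neq0 : forall j, chip j != 0) (chim_neq0 : forall j, chim j != 0)
  (chim_neq1 : forall j, chim j != 1)
  (lam lam' : 'I_r -> R[i])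
  (lamP : log_choice chip chim lam)
  (lam'P : log_choice (alpha_p chip chim) (alpha_m a chip chim) lam')
  (compat : torus_op e hd rho lam' =
     torus_op e hd rho lam *m
     \prod_j rho (phi j (mx2 (1 - chim j) 0 0 (1 - chim j)^-1))) :
  Ch e hd phi word rho lam' (alpha_m a chip chim) =
  Ch e hd phi word rho lam chim.
Proof.
have a2 : forall i, a i i = 2 by case: aP.
have hdX := drepr_hdxp e1 brP aP chevP hdP rhoP.
have hdY := drepr_hdxm e1 brP aP chevP hdP rhoP.
have hdhd := drepr_hdhd e1 brP aP chevP hdP rhoP.
have XY := drepr_xpxm e1 brP chevP rhoP.
have hE := drepr_h e hdP rho.
have uw : uniq word.
  by case: word_coxeter => s s_enum ts; exact: (coxeter_word_uniq a2 s_enum ts).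
have word_enum : perm_eq word (enum 'I_r).
  have sz : (size (enum 'I_r) <= size word)%N by rewrite size_tuple size_enum_ord.
  have sub : {subset (word : seq _) <= enum 'I_r} by move=> j _; rewrite mem_enum.
  by apply: uniq_perm => //; [exact: enum_uniq|case: (uniq_min_size uw sub sz)].
have t0 i : 1 - chim i != 0 by rewrite subr_eq0 eq_sym.
(* Logarithms of [1 - chim i] turn the diagonal factors into exponentials of coroots. *)
have /choice[mu muE] : forall i, exists w : R[i], expC w = 1 - chim i.
  by move=> i; exact: expC_surj.
have compat' : torus_op e hd rho lam' =
    torus_op e hd rho lam *m \prod_(k <- word) expm (mu k *: drepr e rho (h k)).
  rewrite compat (coroot_prod_perm hdhd hE _ word_enum); congr (_ *m _).
  apply: eq_bigr => j _.
  by rewrite -muE (rho_phi_diag e1 rhoP (phiP j)).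
rewrite /Ch !(rho_prod rhoP).
have -> : \prod_(i <- word) rho (phi i (gmx (alpha_m a chip chim i))) =
    \prod_(i <- word) (expm (alpha_m a chip chim i *: drepr e rho (xp i)) *m
                       expm (-1 *: drepr e rho (xm i))).
  by apply: eq_bigr => i _; exact: rho_gmx_EF.
have -> : \prod_(i <- word) rho (phi i (gmx (chim i))) =
    \prod_(i <- word) (expm (- (1 - chim i)^-1 *: drepr e rho (xm i)) *m
      expm (mu i *: drepr e rho (h i)) *m
      expm (chim i / (1 - chim i) *: drepr e rho (xp i))).
  by apply: eq_bigr => i _; exact: rho_gmx_FDE.
have TE l : torus_op e hd rho l = expm (\sum_i l i *: drepr e rho (hd i)).
  exact: torus_prod hdhd l.
rewrite !TE in compat' *.
(* [expm_intertwine] is applied twice, exponentiating one of the two commuting matrices at a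
   time. *)
have EF i j x y : i != j ->
    expm (x *: drepr e rho (xp i)) * expm (y *: drepr e rho (xm j)) =
    expm (y *: drepr e rho (xm j)) * expm (x *: drepr e rho (xp i)).
  move=> ij; apply/expm_intertwine/esym/expm_intertwine.
  by rewrite -!scalemxAl -!scalemxAr XY// !scalerA mulrC.
have alpha0 i : alpha_m a chip chim i != 0.
  rewrite /alpha_m mulf_neq0//; first by rewrite mulf_neq0 ?invr_neq0// expf_neq0.
  by apply/prodf_neq0 => j _; rewrite expfz_neq0.
(* [lam'P] has the required form because [alpha_p chip chim] is [chim] by conversion. *)
exact: (@trace_invariance R r n a a2
  (fun i x => expm (x *: drepr e rho (xp i))) (fun i x => expm (x *: drepr e rho (xm i)))
  (fun l => expm (\sum_i l i *: drepr e rho (hd i)))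
  (torus_E hdX) (torus_F hdY) (torus_comm hdhd) (torusN hdhd) EF
  word chim (alpha_m a chip chim) mu lam lam' (fun i => expm (mu i *: drepr e rho (h i)))
  uw chim_neq0 alpha0 muE lam'P (fun k => expm_coroot hE (mu k) k) compat').
Qed.
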